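(* Let $\nu>0$, $\gamma>0$, $L_\Omega>0$, $\Omega=(0,L_\Omega)^3$. Let $f=f(x)$ be a smooth, time-independent, not identically zero, $\Omega$-periodic, mean-zero, divergence-free vector field with values in $\mathbb{R}^3$, and let $u_0$ be an $\Omega$-periodic, mean-zero, divergence-free initial velocity. Let $u(x,t)$ be a weak solution (in the sense defined in the context), $\Omega$-periodic in $x$ and with zero spatial mean, of $$u_t+\operatorname{div}(u\otimes u)-\tfrac12(\nabla\cdot u)u-\nu\Delta u-\gamma\nabla(\nabla\cdot u)=f(x),\qquad u(x,0)=u_0(x).$$ Then, with $\langle\varepsilon(u)\rangle$, $U$, $L$, $\kappa$, $\mathcal{R}e$, $\mathcal{R}_\gamma$ as defined in the context, $$\langle\varepsilon(u)\rangle\le\left(6+\mathcal{R}e^{-1}+\tfrac14\kappa^2\mathcal{R}_\gamma\right)\frac{U^3}{L}.$$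
   Context: Setting: $\Omega=(0,L_\Omega)^3$ is a three-dimensional periodic box. A function $\phi$ is $\Omega$-periodic if $\phi(x+L_\Omega e_j)=\phi(x)$ for $j=1,2,3$, where $e_j$ are the standard basis vectors, and has zero mean if $\int_\Omega\phi\,dx=0$. The functions $u(\cdot,t)$, $u_0$ and $f$ are all $\Omega$-periodic with zero mean, and $\nabla\cdot u_0=0$, $\nabla\cdot f=0$. The solution $u$ itself is not required to be divergence free. Notation: $(\cdot,\cdot)$ and $\|\cdot\|$ are the $L^2(\Omega)$ inner product and norm, $|\Omega|=L_\Omega^3$, and $|\cdot|$ is the Euclidean norm of vectors (Frobenius norm of matrices). Weak solution: a weak solution is a ($\Omega$-periodic) distributional solution of the equation with initial value $u_0$ that satisfies, for $T>0$, the energy inequality $$\tfrac12\|u(T)\|^2+\int_0^T\left(\nu\|\nabla u(t)\|^2+\gamma\|\nabla\cdot u(t)\|^2\right)dt\le\tfrac12\|u(0)\|^2+\int_0^T(f,u(t))\,dt.$$ Time average: $\langle\phi\rangle=\limsup_{T\to\infty}\frac1T\int_0^T\phi(t)\,dt$. Energy dissipation rate: $\varepsilon(u)(t)=\frac{1}{|\Omega|}\int_\Omega\left(\nu|\nabla u(x,t)|^2+\gamma|\nabla\cdot u(x,t)|^2\right)dx$, and $\langle\varepsilon(u)\rangle$ is its time average. Scales and parameters: $$F=\left(\tfrac1{|\Omega|}\|f\|^2\right)^{1/2},\qquad U=\left\langle\tfrac1{|\Omega|}\|u\|^2\right\rangle^{1/2},$$ $$L=\min\left\{L_\Omega,\ \frac{F}{\|\nabla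 f\|_{L^\infty}},\ \frac{F}{\left(\frac1{|\Omega|}\|\nabla f\|^2\right)^{1/2}}\right\},$$ $$\kappa=\sqrt{\frac{\|f\|_{L^\infty}^2}{\frac1{|\Omega|}\int_\Omega|f(x)|^2\,dx}},\qquad \mathcal{R}e=\frac{LU}{\nu},\qquad \mathcal{R}_\gamma=\frac{LU}{\gamma}.$$ *)

(* Defs.v *)
From HB Require Import structures.
From mathcomp Require Import all_boot all_order all_algebra.
From mathcomp Require Import all_classical all_reals all_analysis.

Set Implicit Arguments.
Unset Strict Implicit.
Unset Printing Implicit Defensive.

Import Order.TTheory GRing.Theory Num.Theory.
Import numFieldNormedType.Exports.

Local Open Scope classical_set_scope.
Local Open Scope ring_scope.

(* Points of R^3 are triples, because products carry both a normed-module     *)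
(* structure and a product measure; vector fields take values in 'rV[R]_3.    *)
(* measurableTypeR R is R itself, so that R3m R and R3 R are convertible; the *)
(* former is used only where Borel sets or Lebesgue measure are involved.     *)
Notation R3 R := (Real.sort R * Real.sort R * Real.sort R)%type.
Notation R3m R :=
  (measurableTypeR R * measurableTypeR R * measurableTypeR R)%type.

Definition leb3 (R : realType) : set (R3m R) -> \bar R :=
  ((@lebesgue_measure R \x @lebesgue_measure R) \x @lebesgue_measure R)%E.

HB.instance Definition _ (R : realType) := Measure.on (@leb3 R).

(* The library's sigma-finiteness instance for \x is shadowed by the one for   *)
(* probabilities, so it is not inferred.                                      *)
Lemma leb3_sigma_finite (R : realType) : sigma_finite setT (@leb3 R).
Proof.
have /sigma_finiteP[F [TF ndF Foo]] := sigma_finiteT (@lebesgue_measure R).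
exists (fun n => F n `*` F n `*` F n).
  rewrite predeqE => -[[x y] z]; split=> // _.
  have inF (w : R) : exists2 n, True & F n w.
    by have : [set: measurableTypeR R] w by []; rewrite TF.
  have [[n _ Fx] [m _ Fy] [k _ Fz]] := And3 (inF x) (inF y) (inF z).
  exists (maxn (maxn n m) k) => //.
  have le1 : (n <= maxn (maxn n m) k)%N.
    exact: leq_trans (leq_maxl n m) (leq_maxl _ _).
  have le2 : (m <= maxn (maxn n m) k)%N.
    exact: leq_trans (leq_maxr n m) (leq_maxl _ _).
  split; [split|].
  - by move: Fx; exact/subsetPset/ndF.
  - by move: Fy; exact/subsetPset/ndF.
  - by move: Fz; exact/subsetPset/ndF/leq_maxr.
move=> n; have [mF Fn] := Foo n.
split; first by do 2 (apply: measurableX => //).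
have F2 : ((@lebesgue_measure R \x @lebesgue_measure R) (F n `*` F n) < +oo)%E.
  have -> := @product_measure1E _ _ _ _ _ (@lebesgue_measure R)
    (@lebesgue_measure R) _ _ mF mF.
  by rewrite lte_mul_pinfty// ge0_fin_numE.
rewrite /leb3.
have -> := @product_measure1E _ _ _ _ _
  (@lebesgue_measure R \x @lebesgue_measure R)%E (@lebesgue_measure R)
  _ _ (measurableX mF mF) mF.
by rewrite lte_mul_pinfty// ge0_fin_numE.
Qed.

HB.instance Definition _ (R : realType) :=
  @Measure_isSigmaFinite.Build _ _ _ (@leb3 R) (@leb3_sigma_finite R).

Definition Omega (R : realType) (l : R) : set (R3m R) :=
  `]0, l[ `*` `]0, l[ `*` `]0, l[.

Definition stdbasis (R : realType) (j : 'I_3) : R3 R :=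
  ((j == 0%N :> nat)%:R, (j == 1%N :> nat)%:R, (j == 2%N :> nat)%:R).

Definition space_periodic (R : realType) (T : Type) (l : R) (v : R3 R -> T)
    : Prop :=
  forall (j : 'I_3) (x : R3 R), v (x + l *: stdbasis R j) = v x.

Definition zero_mean (R : realType) (l : R) (v : R3 R -> 'rV[R]_3) : Prop :=
  forall i, \int[@leb3 R]_(x in Omega l) v x 0 i = 0.

(* Smoothness: iterated directional derivatives of every order, in arbitrary  *)
(* directions, exist and are continuous; on a finite-dimensional V this is    *)
(* membership in C^infinity.                                                  *)
Definition iter_derive (R : realType) (V : normedModType R) (vs : seq V)
    (g : V -> R) : V -> R :=
  foldr (fun v h => fun x => 'D_v h x) g vs.

Definition smooth (R : realType) (V : normedModType R) (g : V -> R) : Prop :=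
  forall vs : seq V, continuous (iter_derive vs g) /\
    forall x v, derivable (iter_derive vs g) x v.

Definition smooth_field (R : realType) (v : R3 R -> 'rV[R]_3) : Prop :=
  forall i, smooth (fun x : R3 R => v x 0 i).

Definition partial (R : realType) (j : 'I_3) (g : R3 R -> R) (x : R3 R) : R :=
  'D_(stdbasis R j) g x.

Definition grad (R : realType) (v : R3 R -> 'rV[R]_3) (x : R3 R) : 'M[R]_3 :=
  \matrix_(i, j) partial j (fun y => v y 0 i) x.

Definition div (R : realType) (v : R3 R -> 'rV[R]_3) (x : R3 R) : R :=
  \tr (grad v x).

Definition laplacian (R : realType) (v : R3 R -> 'rV[R]_3) (x : R3 R)
    : 'rV[R]_3 :=
  \row_i \sum_j partial j (partial j (fun y => v y 0 i)) x.

Definition grad_div (R : realType) (v : R3 R -> 'rV[R]_3) (x : R3 R)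
    : 'rV[R]_3 :=
  \row_i partial i (div v) x.

Definition time_derive (R : realType) (phi : R -> R3 R -> 'rV[R]_3) (t : R)
    (x : R3 R) : 'rV[R]_3 :=
  \row_i derive1 (fun s => phi s x 0 i) t.

(* Euclidean inner product of vectors (m = 1), Frobenius one of matrices.     *)
Definition mxdot (R : realType) (m n : nat) (A B : 'M[R]_(m, n)) : R :=
  \sum_i \sum_j A i j * B i j.

Definition mxnorm (R : realType) (m n : nat) (A : 'M[R]_(m, n)) : R :=
  Num.sqrt (mxdot A A).

Definition inner (R : realType) (l : R) (m n : nat)
    (v w : R3 R -> 'M[R]_(m, n)) : R :=
  \int[@leb3 R]_(x in Omega l) mxdot (v x) (w x).

Definition normsq (R : realType) (l : R) (g : R3 R -> R) : \bar R :=
  (\int[@leb3 R]_(x in Omega l) (g x ^+ 2)%:E)%E.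

Definition norm_inf (R : realType) (l : R) (g : R3 R -> R) : R :=
  fine ('N[@leb3 R]_+oo[(EFin \o g) \_ (Omega l)])%E.

(* G is the distributional gradient of v on the torus: test functions are     *)
(* periodic, not compactly supported in the box.                              *)
Definition weak_gradient (R : realType) (l : R) (v : R3 R -> 'rV[R]_3)
    (G : R3 R -> 'M[R]_3) : Prop :=
  forall psi : R3 R -> R, smooth psi -> space_periodic l psi ->
  forall i j : 'I_3,
    \int[@leb3 R]_(x in Omega l) (v x 0 i * partial j psi x) =
    - \int[@leb3 R]_(x in Omega l) (G x i j * psi x).

Definition weakly_div_free (R : realType) (l : R) (v : R3 R -> 'rV[R]_3)
    : Prop :=
  forall psi : R3 R -> R, smooth psi -> space_periodic l psi ->
    \int[@leb3 R]_(x in Omega l) (\sum_j v x 0 j * partial j psi x) = 0.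

(* Restricted to t >= 0, these are the test functions of compact support in   *)
(* [0, +oo) x torus; they need not vanish at t = 0.                           *)
Definition test_field (R : realType) (l : R) (phi : R -> R3 R -> 'rV[R]_3)
    : Prop :=
  [/\ forall i, smooth (fun z : R * R3 R => phi z.1 z.2 0 i),
      forall t, space_periodic l (phi t) &
      exists T : R, forall t x, T <= t -> phi t x = 0].

(* The equation of
     u_t + div (u (x) u) - (1/2) (div u) u - nu Lap u - gamma grad (div u) = f,
   u(0) = u0, tested against phi; Du is the weak gradient of u, so that
   \tr Du is its weak divergence. *)
Definition distributional_solution (R : realType) (l nu gamma : R)
    (f u0 : R3 R -> 'rV[R]_3) (u : R -> R3 R -> 'rV[R]_3)
    (Du : R -> R3 R -> 'M[R]_3) : Prop :=
  forall phi : R -> R3 R -> 'rV[R]_3, test_field l phi ->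
    \int[@lebesgue_measure R]_(t in `[0, +oo[)
      (- inner l (u t) (time_derive phi t)
       - inner l (fun x => (u t x)^T *m u t x) (grad (phi t))
       - 2^-1 * inner l (fun x => \tr (Du t x) *: u t x) (phi t)
       - nu * inner l (u t) (laplacian (phi t))
       - gamma * inner l (u t) (grad_div (phi t)))
    = inner l u0 (phi 0)
      + \int[@lebesgue_measure R]_(t in `[0, +oo[) inner l f (phi t).

(* u is of class L^2(0, T; H^1) for every T > 0, with gradient Du.            *)
Definition energy_class (R : realType) (l : R) (u : R -> R3 R -> 'rV[R]_3)
    (Du : R -> R3 R -> 'M[R]_3) : Prop :=
  [/\ forall i, measurable_fun
        (`[0, +oo[ `*` Omega l : set (measurableTypeR R * R3m R))
        (fun z => u z.1 z.2 0 i),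
      forall i j, measurable_fun
        (`[0, +oo[ `*` Omega l : set (measurableTypeR R * R3m R))
        (fun z => Du z.1 z.2 i j),
      forall T : R, 0 < T ->
        (\int[@lebesgue_measure R]_(t in `[0%R, T])
          (normsq l (fun x => mxnorm (u t x)) +
           normsq l (fun x => mxnorm (Du t x))) < +oo)%E &
      {ae @lebesgue_measure R, forall t, 0 < t ->
        weak_gradient l (u t) (Du t)}].

Definition energy_inequality (R : realType) (l nu gamma : R)
    (f : R3 R -> 'rV[R]_3) (u : R -> R3 R -> 'rV[R]_3)
    (Du : R -> R3 R -> 'M[R]_3) : Prop :=
  forall T : R, 0 < T ->
    ((2^-1)%:E * normsq l (fun x => mxnorm (u T x))
     + \int[@lebesgue_measure R]_(t in `[0%R, T])
         (nu%:E * normsq l (fun x => mxnorm (Du t x))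
          + gamma%:E * normsq l (fun x => \tr (Du t x)))
     <= (2^-1)%:E * normsq l (fun x => mxnorm (u 0%R x))
        + (\int[@lebesgue_measure R]_(t in `[0, T]) inner l f (u t))%R%:E)%E.

Definition weak_solution (R : realType) (l nu gamma : R)
    (f u0 : R3 R -> 'rV[R]_3) (u : R -> R3 R -> 'rV[R]_3)
    (Du : R -> R3 R -> 'M[R]_3) : Prop :=
  [/\ energy_class l u Du,
      {ae @leb3 R, forall x, Omega l x -> u 0 x = u0 x},
      distributional_solution l nu gamma f u0 u Du &
      energy_inequality l nu gamma f u Du].

Definition time_average (R : realType) (phi : R -> \bar R) : \bar R :=
  limf_esup
    (fun T : R =>
       ((T^-1)%:E * \int[@lebesgue_measure R]_(t in `[0%R, T]) phi t)%E)
    (pinfty_nbhs R).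

Definition vol (R : realType) (l : R) : R := l ^+ 3.

Definition dissipation (R : realType) (l nu gamma : R)
    (Dv : R3 R -> 'M[R]_3) : \bar R :=
  ((vol l)^-1%:E *
   \int[@leb3 R]_(x in Omega l)
     (nu * mxnorm (Dv x) ^+ 2 + gamma * (\tr (Dv x)) ^+ 2)%:E)%E.

Definition mean_sq (R : realType) (l : R) (g : R3 R -> R) : R :=
  (vol l)^-1 * fine (normsq l g).

Definition F_scale (R : realType) (l : R) (f : R3 R -> 'rV[R]_3) : R :=
  Num.sqrt (mean_sq l (fun x => mxnorm (f x))).

Definition L_scale (R : realType) (l : R) (f : R3 R -> 'rV[R]_3) : R :=
  Num.min l
    (Num.min (F_scale l f / norm_inf l (fun x => mxnorm (grad f x)))
             (F_scale l f /
              Num.sqrt (mean_sq l (fun x => mxnorm (grad f x))))).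

Definition kappa (R : realType) (l : R) (f : R3 R -> 'rV[R]_3) : R :=
  Num.sqrt (norm_inf l (fun x => mxnorm (f x)) ^+ 2 /
            mean_sq l (fun x => mxnorm (f x))).

(* U, and hence the two Reynolds numbers, are kept extended-real valued, so   *)
(* that no finiteness of the limsup is presupposed.                           *)
Definition U_scale (R : realType) (l : R) (u : R -> R3 R -> 'rV[R]_3) : \bar R :=
  sqrte (time_average
    (fun t => (vol l)^-1%:E * normsq l (fun x => mxnorm (u t x)))%E).

Definition reynolds (R : realType) (l nu : R) (f : R3 R -> 'rV[R]_3)
    (u : R -> R3 R -> 'rV[R]_3) : \bar R :=
  ((L_scale l f)%:E * U_scale l u / nu%:E)%E.

Definition reynolds_gamma (R : realType) (l gamma : R) (f : R3 R -> 'rV[R]_3)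
    (u : R -> R3 R -> 'rV[R]_3) : \bar R :=
  ((L_scale l f)%:E * U_scale l u / gamma%:E)%E.

(* Main.v *)
Require Import Defs.
From HB Require Import structures.
From mathcomp Require Import all_boot all_order all_algebra.
From mathcomp Require Import all_classical all_reals all_analysis.
From mathcomp Require Import measurable_realfun ess_sup_inf.
From mathcomp Require Import ring lra.

(* Testing the equation with theta(t) f(x), where theta is a smooth cutoff of
   [0, T], bounds F^2 by time averages over [0, T]; the gamma-term vanishes
   because div f = 0. Multiplied by U/F and after Young's inequality it reads
     F U <= U^3/L + kappa^2 U^4/(8 gamma) + nu U^2/(2 L^2) + <eps>/2 + o(1),
   while the energy inequality gives <eps> <= F U + o(1). Eliminating F U yields
     <eps> <= (2 + 1/Re + kappa^2 R_gamma/4) U^3/L.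
   The degenerate cases follow the conventions of \bar R: if U = 0 the energy
   inequality alone gives <eps> <= 0, and if L = 0 < U or U = +oo the right-hand
   side is +oo. *)

Set Implicit Arguments.
Unset Strict Implicit.
Unset Printing Implicit Defensive.
Import Order.TTheory GRing.Theory Num.Theory.
Import numFieldNormedType.Exports.

Local Open Scope classical_set_scope.
Local Open Scope ring_scope.

(** * Smooth functions *)

(** A sharp cutoff at time T would leave a boundary term (u(T), f), which the distributional
    formulation does not provide. The smooth cutoff moves it into theta', of size n/T; with n fixed
    these terms are O(1/T) after averaging, and the price is a factor (1 - d)^2 in front of F^2. The
    parameter d is sent to 0 only after T. One Young weight s runs through both balances. The
    viscous term and the term with div u are split so that together they cost exactly (2s)^-1 times
    nu |Du|^2 + gamma |div u|^2, while the convective term needs the sup norm of grad f because u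
    (x) u is merely integrable. At s = U/F, multiplication by s turns that cost into <eps>/2, and
    the power input s F^2/2 + U^2/(2s) becomes F U. The time dependence of the real inner products
    is never shown to be measurable, and a real integral is 0 by default when it is infinite. All
    bounds therefore go through nonnegative extended-real majorants built from [kinetic] and
    [power], measurable in time by Tonelli and allowed to be +oo at exceptional times. *)

Definition smooth_upto (R : realType) (V : normedModType R) (n : nat)
    (g : V -> R) :=
  forall vs : seq V, (size vs <= n)%N -> continuous (iter_derive vs g) /\
    forall x v, derivable (iter_derive vs g) x v.

Section SmoothUpto.
Context {R : realType} {V : normedModType R}.
Implicit Types f g : V -> R.

(** The last direction of the list is the one differentiated first, so inductions on the order peel
    lists from the right. *)
Lemma iter_derive_rcons (vs : seq V) v g :
  iter_derive (rcons vs v) g = iter_derive vs (fun x => 'D_v g x).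
Proof. by rewrite /iter_derive foldr_rcons. Qed.

(** Grading by the order is what permits induction: the derivative of a sum, product or composite at
    order [n.+1] is an expression in functions of order [n]. *)
Lemma smoothP g : smooth g <-> forall n, smooth_upto n g.
Proof.
split=> [sg n vs _|sg vs]; first exact: sg.
exact: (sg (size vs) vs (leqnn _)).
Qed.

Lemma smooth_upto_derive n g :
  (continuous g /\ forall x v, derivable g x v) ->
  (forall v, smooth_upto n (fun x => 'D_v g x)) -> smooth_upto n.+1 g.
Proof.
move=> g0 gS vs; case/lastP: vs => [_|vs v]; first exact: g0.
by rewrite size_rcons ltnS iter_derive_rcons; exact: gS.
Qed.

Lemma derive_smooth_upto n g v :
  smooth_upto n.+1 g -> smooth_upto n (fun x => 'D_v g x).
Proof.
by move=> sg vs svs; rewrite -iter_derive_rcons; apply: sg; rewrite size_rcons.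
Qed.

Lemma smooth_upto0 n g : smooth_upto n g ->
  continuous g /\ forall x v, derivable g x v.
Proof. by move=> sg; exact: (sg [::]). Qed.

Lemma smooth_upto_le m n g : (m <= n)%N -> smooth_upto n g -> smooth_upto m g.
Proof. by move=> mn sg vs vsm; apply: sg; exact: leq_trans mn. Qed.

Lemma smooth_uptoD n f g : smooth_upto n f -> smooth_upto n g ->
  smooth_upto n (fun x => f x + g x).
Proof.
elim: n f g => [|n ih] f g sf sg.
  move=> [|//] _.
  have [[cf df] [cg dg]] := (smooth_upto0 sf, smooth_upto0 sg).
  split=> [x|x v]; first by apply: cvgD; [exact: cf|exact: cg].
  by apply: derivableD; [exact: df|exact: dg].
have [[cf df] [cg dg]] := (smooth_upto0 sf, smooth_upto0 sg).
apply: smooth_upto_derive.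
  split=> [x|x v]; first by apply: cvgD; [exact: cf|exact: cg].
  by apply: derivableD; [exact: df|exact: dg].
move=> v; rewrite (_ : (fun x => _) = fun x => 'D_v f x + 'D_v g x).
  by apply: ih; exact: derive_smooth_upto.
by apply/funext => x; rewrite -deriveD.
Qed.

Lemma smooth_uptoM n f g : smooth_upto n f -> smooth_upto n g ->
  smooth_upto n (fun x => f x * g x).
Proof.
elim: n f g => [|n ih] f g sf sg.
  move=> [|//] _.
  have [[cf df] [cg dg]] := (smooth_upto0 sf, smooth_upto0 sg).
  split=> [x|x v]; first by apply: cvgM; [exact: cf|exact: cg].
  by apply: derivableM; [exact: df|exact: dg].
have [[cf df] [cg dg]] := (smooth_upto0 sf, smooth_upto0 sg).
apply: smooth_upto_derive.
  split=> [x|x v]; first by apply: cvgM; [exact: cf|exact: cg].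
  by apply: derivableM; [exact: df|exact: dg].
move=> v.
rewrite (_ : (fun x => _) = fun x => f x * 'D_v g x + g x * 'D_v f x).
  apply: smooth_uptoD; apply: ih; try exact: derive_smooth_upto.
  - exact: smooth_upto_le sf.
  - exact: smooth_upto_le sg.
by apply/funext => x; rewrite -[in RHS]deriveM.
Qed.

Lemma smooth_upto_cst n (c : R) : smooth_upto n (fun _ : V => c).
Proof.
have c0 (c' : R) : continuous (fun _ : V => c') /\
    forall x v, derivable (fun _ : V => c') x v.
  by split=> [x|x v]; [exact: cvg_cst|exact: derivable_cst].
elim: n c => [|n ih] c; first by move=> [|//] _; exact: c0.
apply: smooth_upto_derive => // v.
by under eq_fun do rewrite derive_cst; exact: ih.
Qed.

End SmoothUpto.

(** The difference quotients of [g \o fst] along [v] are convertible to those of [g] along [v.1], so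
    the induction needs no chain rule. *)
Lemma smooth_upto_fst (R : realType) (V W : normedModType R) n (g : V -> R) :
  smooth_upto n g -> smooth_upto n (fun z : V * W => g z.1).
Proof.
have fst0 (h : V -> R) : continuous h /\ (forall x v, derivable h x v) ->
    continuous (fun z : V * W => h z.1) /\
    forall x v, derivable (fun z : V * W => h z.1) x v.
  move=> [ch dh]; split=> [z|z v]; last exact: (dh z.1 v.1).
  by apply: (@continuous_comp _ _ _ fst h); [exact: cvg_fst|exact: ch].
elim: n g => [|n ih] g sg.
  by move=> [|//] _; apply: fst0; exact: smooth_upto0 sg.
apply: smooth_upto_derive; first by apply: fst0; exact: smooth_upto0 sg.
move=> v; apply: (ih (fun x => 'D_v.1 g x)); exact: derive_smooth_upto.
Qed.

Lemma smooth_upto_snd (R : realType) (V W : normedModType R) n (g : W -> R) :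
  smooth_upto n g -> smooth_upto n (fun z : V * W => g z.2).
Proof.
have snd0 (h : W -> R) : continuous h /\ (forall x v, derivable h x v) ->
    continuous (fun z : V * W => h z.2) /\
    forall x v, derivable (fun z : V * W => h z.2) x v.
  move=> [ch dh]; split=> [z|z v]; last exact: (dh z.2 v.2).
  by apply: (@continuous_comp _ _ _ snd h); [exact: cvg_snd|exact: ch].
elim: n g => [|n ih] g sg.
  by move=> [|//] _; apply: snd0; exact: smooth_upto0 sg.
apply: smooth_upto_derive; first by apply: snd0; exact: smooth_upto0 sg.
move=> v; apply: (ih (fun x => 'D_v.2 g x)); exact: derive_smooth_upto.
Qed.

(** Since the difference quotients themselves coincide, derivability and the value of the derivative
    both transfer by rewriting. *)
Lemma growth_affine (R : realType) (g : R -> R) (a b x v : R) :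
  (fun h => h^-1 *: (((fun t => g (a * t + b)) \o shift x) (h *: v)
                     - g (a * x + b)))
  = (fun h => h^-1 *: ((g \o shift (a * x + b)) (h *: (a * v))
                     - g (a * x + b))).
Proof.
apply/funext => h /=; congr (_ *: (g _ - _)).
by rewrite /GRing.scale/=; ring.
Qed.

Lemma derivable_affine (R : realType) (g : R -> R) (a b x v : R) :
  derivable g (a * x + b) (a * v) -> derivable (fun t => g (a * t + b)) x v.
Proof. by rewrite /derivable growth_affine. Qed.

Lemma derive_affine (R : realType) (g : R -> R) (a b x v : R) :
  'D_v (fun t => g (a * t + b)) x = 'D_(a * v) g (a * x + b).
Proof. by rewrite /derive growth_affine. Qed.

Lemma smooth_upto_affine (R : realType) n (g : R -> R) (a b : R) :
  smooth_upto n g -> smooth_upto n (fun t : R => g (a * t + b)).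
Proof.
have aff0 (h : R -> R) : continuous h /\ (forall x v, derivable h x v) ->
    continuous (fun t => h (a * t + b)) /\
    forall x v, derivable (fun t => h (a * t + b)) x v.
  move=> [ch dh]; split=> [z|z v]; last exact/derivable_affine/dh.
  apply: (@continuous_comp _ _ _ (fun t => a * t + b) h); last exact: ch.
  apply: cvgD; last exact: cvg_cst.
  by apply: cvgM; [exact: cvg_cst|exact: cvg_id].
elim: n g => [|n ih] g sg.
  by move=> [|//] _; apply: aff0; exact: smooth_upto0 sg.
apply: smooth_upto_derive; first by apply: aff0; exact: smooth_upto0 sg.
move=> v; under eq_fun do rewrite derive_affine.
by apply: (ih (fun x => 'D_(a * v) g x)); exact: derive_smooth_upto.
Qed.

(** * The flat function exp(-1/x) and separated test fields *)

Section Flat.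
Context {R : realType}.
Implicit Types (x y : R) (k n : nat).

(** The exponent [k] closes the family under differentiation: the derivative of [flat k] is a
    combination of [flat k.+2] and [flat k.+1], so one induction proves all members smooth. *)
Definition flat k x : R := if 0 < x then x^-1 ^+ k * expR (- x^-1) else 0.

(** A single term y^k / k! of the exponential series is at most [expR y]. *)
Lemma expRN_exprn_le k y : 0 <= y -> y ^+ k * expR (- y) <= k`!%:R.
Proof.
move=> y0; case: k => [|k].
  by rewrite expr0 mul1r fact0 expR_le1 oppr_le0.
rewrite expRN ler_pdivrMr ?expR_gt0// -ler_pdivrMl ?ltr0n ?fact_gt0//.
rewrite mulrC; apply: le_trans (expR_ge1Dxn k y0).
by rewrite lerDr.
Qed.

Lemma flat_ge0 k x : 0 <= flat k x.
Proof.
rewrite /flat; case: ifPn => // x0.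
by rewrite mulr_ge0 ?expR_ge0 ?exprn_ge0 ?invr_ge0 1?ltW.
Qed.

Lemma flat_le k x : flat k x <= k`!%:R.
Proof.
rewrite /flat; case: ifPn => // x0.
by apply: expRN_exprn_le; rewrite invr_ge0 ltW.
Qed.

(** For x > 0, [flat k x] is x^2 times [flat k.+2 x], which is bounded. Quadratic decay is what
    makes the derivative at 0 vanish. *)
Lemma flat_le_sqr k x : flat k x <= k.+2`!%:R * x ^+ 2.
Proof.
have [x0|x0] := ltP 0 x; last first.
  by rewrite /flat ltNge x0 mulr_ge0 ?sqr_ge0.
have := flat_le k.+2 x; rewrite /flat x0 2!exprS => h.
rewrite -ler_pdivrMr ?exprn_gt0//; apply: le_trans h.
by rewrite le_eqVlt; apply/orP; left; apply/eqP; field; rewrite gt_eqF.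
Qed.

Lemma is_derive_flat k x :
  is_derive x 1 (flat k) (flat k.+2 x - k%:R * flat k.+1 x).
Proof.
have [x0|x0|<-{x}] := ltgtP 0 x.
- have e : \near x, x^-1 ^+ k * expR (- x^-1) = flat k x.
    near=> y; rewrite /flat ifT//.
    by near: y; exact: lt_nbhsr.
  apply: near_eq_is_derive e _.
  have xn0 : x != 0 by rewrite gt_eqF.
  have dV : is_derive x 1 (fun y : R => y^-1) (- x ^- 2).
    have := @is_deriveV _ id x 1 1 xn0 (is_derive_id _ _).
    by rewrite /GRing.scale /= mulr1.
  rewrite [X in is_derive _ _ X](_ : _ =
    ((fun y : R => y^-1) ^+ k) * (expR \o (fun y => - y^-1))); last first.
    by rewrite exprfctE.
  have dE : is_derive x 1 (expR \o (fun y => - y^-1)) (expR (- x^-1) * x ^- 2).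
    by apply: is_derive1_comp; apply: is_derive_eq; rewrite opprK.
  apply: is_derive_eq; rewrite /flat x0 /GRing.scale exprfctE /=.
  by rewrite -exprVn; case: k => [|k] /=; rewrite ?expr0 ?exprS; ring.
- have e : \near x, 0 = flat k x.
    near=> y; rewrite /flat ltNge ifF//; apply/negbTE; rewrite negbK ltW//.
    by near: y; exact: lt_nbhsl.
  apply: near_eq_is_derive e _.
  by rewrite /flat !ltNge (ltW x0)/= mulr0 subrr; exact: is_derive_cst.
(* At the origin the difference quotient is at most (k+2)! |h| in absolute value, by
   [flat_le_sqr]. *)
- rewrite {2 3}/flat ltxx mulr0 subrr.
  have F0 : h^-1 *: ((flat k \o shift 0) (h *: 1) - flat k 0) @[h --> 0^'] -->
    0.
    apply/cvgrPdist_le => /= e e0; near=> h.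
    rewrite sub0r normrN /= addr0 {2}/flat ltxx subr0 [h%:A]mulr1.
    have h0 : h != 0 by near: h; exact: nbhs_dnbhs_neq.
    rewrite /GRing.scale /= normrM (ger0_norm (flat_ge0 _ _)).
    apply: (@le_trans _ _ (`|h^-1| * (k.+2`!%:R * h ^+ 2))).
      by apply: ler_wpM2l => //; exact: flat_le_sqr.
    rewrite -[h ^+ 2]ger0_norm ?sqr_ge0// mulrCA -normrM expr2 mulrA mulVf//
      mul1r.
    rewrite -ler_pdivlMl ?ltr0n ?fact_gt0//.
    near: h; apply: dnbhs0_le.
    by rewrite mulr_gt0 ?invr_gt0 ?ltr0n ?fact_gt0.
  apply: DeriveDef; last exact: cvg_lim F0.
  by apply/cvg_ex; exists 0.
Unshelve. all: by end_near. Qed.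

Lemma derive_flat k x v :
  derivable (flat k) x v /\
  'D_v (flat k) x = v * (flat k.+2 x - k%:R * flat k.+1 x).
Proof.
have [dk ek] := is_derive_flat k x.
have df : differentiable (flat k) x by exact/derivable1_diffP.
split; first exact: diff_derivable.
rewrite deriveE// -[v in LHS]mulr1 -[v * 1]/(v *: 1) linearZ -deriveE//= ek//.
Qed.

Lemma smooth_upto_flat n k : smooth_upto n (flat k).
Proof.
have c0 i : continuous (flat i) /\ forall x v, derivable (flat i) x v.
  split=> [x|x v]; last exact: (derive_flat _ _ _).1.
  apply: differentiable_continuous; apply/derivable1_diffP.
  exact: (derive_flat _ _ _).1.
elim: n k => [|n ih] k; first by move=> [|//] _; exact: c0.
apply: smooth_upto_derive => // v.
rewrite (_ : (fun _ => _) =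
    fun x => v * (flat k.+2 x + (- k%:R) * flat k.+1 x)); last first.
  by apply/funext => x; rewrite (derive_flat k x v).2 mulNr.
apply: smooth_uptoM; first exact: smooth_upto_cst.
apply: smooth_uptoD => //.
by apply: smooth_uptoM; first exact: smooth_upto_cst.
Qed.

End Flat.

Section SeparatedTest.
Context {R : realType}.
Implicit Types (g : R3 R -> R) (f : R3 R -> 'rV[R]_3).

Lemma smooth_derivable (V : normedModType R) (g : V -> R) x v :
  smooth g -> derivable g x v.
Proof. by move=> sg; exact: (sg [::]).2. Qed.

Lemma smooth_continuous (V : normedModType R) (g : V -> R) :
  smooth g -> continuous g.
Proof. by move=> sg; exact: (sg [::]).1. Qed.

Lemma smooth_partial j g : smooth g -> smooth (partial j g).
Proof.
move=> /smoothP sg; apply/smoothP => n.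
exact: (@derive_smooth_upto _ _ n g (stdbasis R j) (sg n.+1)).
Qed.

Lemma partialZ j c g x : smooth g ->
  partial j (fun y => c * g y) x = c * partial j g x.
Proof. move=> sg; have dg := smooth_derivable (x := x) (v := stdbasis R j) sg.
exact: (deriveZ c dg). Qed.

Lemma gradZ c f x : smooth_field f ->
  grad (fun y => c *: f y) x = c *: grad f x.
Proof.
move=> sf; apply/matrixP => i j; rewrite !mxE -partialZ//.
by congr partial; apply/funext => y; rewrite mxE.
Qed.

Lemma divZ c f x : smooth_field f ->
  div (fun y => c *: f y) x = c * div f x.
Proof. by move=> sf; rewrite /div gradZ// mxtraceZ. Qed.

Lemma laplacianZ c f x : smooth_field f ->
  laplacian (fun y => c *: f y) x = c *: laplacian f x.
Proof.
move=> sf; apply/rowP => i; rewrite !mxE mulr_sumr; apply: eq_bigr => j _.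
rewrite -partialZ; last exact: smooth_partial.
congr partial; apply/funext => y; rewrite -partialZ//.
by congr partial; apply/funext => z; rewrite mxE.
Qed.

Lemma grad_div_eq0 f x : (forall y, div f y = 0) -> grad_div f x = 0.
Proof.
move=> f0; apply/rowP => i; rewrite !mxE /partial.
by rewrite (_ : div f = cst 0) ?derive_cst//; exact/funext.
Qed.

Lemma time_deriveZ (theta : R -> R) f t x : derivable theta t 1 ->
  time_derive (fun s y => theta s *: f y) t x = derive1 theta t *: f x.
Proof.
move=> dtheta; apply/rowP => i; rewrite !mxE !derive1E.
under eq_fun do rewrite mxE.
by rewrite mulrC -(deriveMr (f x 0 i))//; congr ('D_1 _ t); apply/funext => s
  /=.
Qed.

Lemma test_field_sep l (theta : R -> R) f T : smooth theta ->
  (forall t, T <= t -> theta t = 0) -> smooth_field f -> space_periodic l f ->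
  test_field l (fun t x => theta t *: f x).
Proof.
move=> /smoothP stheta theta0 sf pf; split.
- move=> i; apply/smoothP => n.
  under eq_fun do rewrite mxE.
  apply: smooth_uptoM; first exact: smooth_upto_fst.
  apply: (@smooth_upto_snd _ _ _ n (fun x => f x 0 i)).
  by move/smoothP : (sf i).
- by move=> t j x; rewrite pf.
- by exists T => t x /theta0 ->; rewrite scale0r.
Qed.

End SeparatedTest.

(** * A smooth cutoff of the time interval [0, T] *)

Section Cutoff.
Context {R : realType}.
Variables (n T : R).
Hypotheses (n_gt0 : 0 < n) (T_gt0 : 0 < T).

(* Tends to the indicator of [t < T] as [n] grows; vanishes for [T <= t]. *)
Definition cutoff (t : R) : R := flat 0 (n * (1 - t / T)).

Let cutoffE : cutoff = fun t => flat 0 (- (n / T) * t + n).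
Proof.
apply/funext => t; congr flat; field.
by rewrite gt_eqF.
Qed.

Lemma smooth_cutoff : smooth cutoff.
Proof.
apply/smoothP => k; rewrite cutoffE.
exact/smooth_upto_affine/smooth_upto_flat.
Qed.

Lemma cutoff_ge0 t : 0 <= cutoff t.
Proof. exact: flat_ge0. Qed.

Lemma cutoff_le1 t : cutoff t <= 1.
Proof. exact: (@flat_le R 0). Qed.

Lemma cutoff_eq0 t : T <= t -> cutoff t = 0.
Proof.
move=> Tt; rewrite /cutoff /flat ltNge pmulr_rle0// subr_le0.
by rewrite ler_pdivlMr// mul1r Tt.
Qed.

Lemma derivable_cutoff t : derivable cutoff t 1.
Proof. by have := smooth_cutoff => /smooth_derivable; apply. Qed.

(** The derivative is -(n/T) times a value of [flat 2], and [flat 2] is at most 2! = 2. For fixed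
    [n] the slope is O(1/T). *)
Lemma normr_derive_cutoff t : `|derive1 cutoff t| <= 2 * n / T.
Proof.
rewrite derive1E cutoffE derive_affine (derive_flat _ _ _).2 mul0r subr0 mulr1.
have nT : 0 <= n / T by rewrite divr_ge0 ?ltW.
rewrite normrM normrN !ger0_norm ?flat_ge0//.
rewrite (_ : 2 * n / T = n / T * 2); last by ring.
apply: ler_wpM2l => //.
exact: (@flat_le R 2).
Qed.

Lemma derive_cutoff_eq0 t : T <= t -> derive1 cutoff t = 0.
Proof.
move=> Tt; rewrite derive1E cutoffE derive_affine (derive_flat _ _ _).2.
rewrite mul0r subr0 /flat ifF ?mulr0//; apply/negbTE; rewrite -leNgt.
rewrite mulNr addrC subr_le0 -mulrA ler_pMr// mulrC ler_pdivlMr//.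
by rewrite mul1r.
Qed.

(** The argument of [flat 0] is at least [n * d] on this range, and exp(-y) >= 1 - y. *)
Lemma cutoff_ge d t : 0 < d -> t <= (1 - d) * T ->
  1 - (n * d)^-1 <= cutoff t.
Proof.
move=> d0 tT.
have dt : d <= 1 - t / T by rewrite lerBrDl -lerBrDr ler_pdivrMr.
have nd : 0 < n * d by rewrite mulr_gt0.
have ndt : n * d <= n * (1 - t / T) by rewrite ler_pM2l.
rewrite /cutoff /flat (lt_le_trans nd ndt) expr0 mul1r.
apply: le_trans (expR_ge1Dx _); rewrite lerD2l lerN2.
by rewrite lef_pV2 ?posrE// (lt_le_trans nd).
Qed.

End Cutoff.

(** * Lebesgue measure on the periodic box *)

Section Space.
Context {R : realType}.
Implicit Types (g : R3 R -> R).

Lemma ballR3E (x y : R3 R) e : ball x e y <->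
  [/\ ball x.1.1 e y.1.1, ball x.1.2 e y.1.2 & ball x.2 e y.2].
Proof. by case: x y => [[a b] c] [[a' b'] c']; split=> [[[]]|[]]. Qed.

(** This links the topology of the triples to their product sigma-algebra: an open set is the
    countable union of the cubes it contains with rational centre and radius 1/(n+1). *)
Lemma open_measurable_R3 (U : set (R3 R)) : open U ->
  measurable (U : set (R3m R)).
Proof.
move=> oU.
pose B (i : rat * rat * rat * nat) : set (R3m R) :=
  ball (ratr i.1.1.1 : R) i.2.+1%:R^-1 `*` ball (ratr i.1.1.2 : R) i.2.+1%:R^-1
  `*` ball (ratr i.1.2 : R) i.2.+1%:R^-1.
have -> : U = \bigcup_i (if `[< B i `<=` U >] then B i else set0).
  apply/seteqP; split=> [x Ux|x [i _]]; last first.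
    by case: asboolP => // BU /BU.
  have /nbhs_ballP[e /= e0 eU] : nbhs x U by exact: open_nbhs_nbhs.
  have [n _ ne] := near_infty_natSinv_lt (PosNum [elaborate divr_gt0 e0 (ltr0Sn
    R 1)]).
  have {ne} ne : n.+1%:R^-1 < e / 2 := ne n (leqnn n).
  have n0 : 0 < n.+1%:R^-1 :> R by rewrite invr_gt0 ltr0n.
  have rat_near (a : R) : exists q : rat, ball (ratr q : R) n.+1%:R^-1 a.
    have /rat_in_itvoo[q /itvP qa] : a < a + n.+1%:R^-1 by rewrite ltrDl.
    exists q; rewrite /ball /= ltr_distl qa andbT.
    by rewrite (@lt_trans _ _ a)// ?qa// ltrBlDr ltrDl.
  have [[qa ha] [qb hb] [qc hc]] :=
    And3 (rat_near x.1.1) (rat_near x.1.2) (rat_near x.2).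
  exists (qa, qb, qc, n) => //.
  rewrite asboolT; first by split; [split|].
  move=> y [[/= ya yb] yc]; apply: eU; apply/ballR3E.
  have split_ball (q : rat) (c d : R) : ball (ratr q : R) n.+1%:R^-1 c ->
      ball (ratr q : R) n.+1%:R^-1 d -> ball c e d.
    by move=> qz qw; apply: (@ball_splitr _ _ (ratr q : R)); exact: le_ball
      (ltW ne) _ _.
  by split; [exact: split_ball ha ya|exact: split_ball hb yb|exact: split_ball
    hc yc].
apply: countable_bigcupT_measurable => [|i]; first exact: countableP.
case: asboolP => // _.
have mball (a e : R) : measurable (ball a e : set (measurableTypeR R)).
  by rewrite ball_itv; exact: measurable_itv.
by apply: measurableX; [apply: measurableX|]; exact: mball.
Qed.

Lemma continuous_measurable_R3 g (D : set (R3m R)) : continuous g ->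
  measurable_fun D (g : R3m R -> R).
Proof.
move=> /continuousP cg; apply: measurable_funTS.
apply: (measurability _ (RGenOInfty.measurableE R)).
move=> _ [_ [a ->] <-]; rewrite setTI; apply: open_measurable_R3.
apply: cg; rewrite set_itvE; exact: open_gt.
Qed.

Variable l : R.
Hypothesis l_gt0 : 0 < l.

Lemma measurable_Omega : measurable (Omega l).
Proof. by do 2 apply: measurableX => //. Qed.

Lemma leb3_Omega : leb3 (Omega l) = (vol l)%:E.
Proof.
have lI : @lebesgue_measure R `]0, l[ = l%:E.
  by rewrite lebesgue_measure_itv/= lte_fin l_gt0 -EFinB subr0.
have m1 : measurable (`]0, l[%classic : set (measurableTypeR R)).
  exact: measurable_itv.
have E3 := @product_measure1E _ _ _ _ _
  (@lebesgue_measure R \x @lebesgue_measure R)%E (@lebesgue_measure R)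
  _ _ (measurableX m1 m1) m1.
have E2 := @product_measure1E _ _ _ _ _ (@lebesgue_measure R)
    (@lebesgue_measure R) _ _ m1 m1.
apply: (etrans E3); apply: (etrans (congr1 (fun z => z * _)%E E2)).
transitivity ((l%:E * l%:E) * l%:E)%E.
  exact: (congr1 (fun z => z * z * z)%E lI).
by rewrite -!EFinM /vol 2!exprSr expr1.
Qed.

Lemma continuous_bounded_Omega g : continuous g ->
  exists M, forall x, Omega l x -> `|g x| <= M.
Proof.
move=> cg.
pose K : set (R3 R) := `[0, l] `*` `[0, l] `*` `[0, l].
have cK : compact K by do 2 (apply: compact_setX; last exact: segment_compact);
  exact: segment_compact.
have K0 : K !=set0.
  by exists (0, 0, 0); do ! split; rewrite /= in_itv /= lexx ltW.
have cn : {within K, continuous (fun x => `|g x|)}.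
  apply: continuous_subspaceT => x; apply: cvg_norm; exact: cg.
have [c _ hc] := compact_EVT_max K0 cK cn.
exists `|g c| => x [[x1 x2] x3]; apply: hc; rewrite inE.
by do ! split; exact: subset_itv_oo_cc.
Qed.

Lemma norm_inf_ge0 g : 0 <= norm_inf l g.
Proof. by rewrite /norm_inf fine_ge0// Lnorm_ge0. Qed.

(** The norm of exponent +oo is the essential supremum only when the whole space has positive
    measure. *)
Lemma leb3T_gt0 : (0 < @leb3 R setT)%E.
Proof.
apply: (@lt_le_trans _ _ (leb3 (Omega l))).
  by rewrite leb3_Omega lte_fin exprn_gt0.
by apply: le_measure; rewrite ?inE //; exact: measurable_Omega.
Qed.

Lemma norm_inf_ae g :
  ('N[@leb3 R]_+oo[(EFin \o g) \_ (Omega l)] \is a fin_num)%E ->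
  {ae @leb3 R, forall x, Omega l x -> `|g x| <= norm_inf l g}.
Proof.
move=> gfin.
have := ess_sup_ge (@leb3 R) (abse \o (EFin \o g) \_ (Omega l)).
apply: filterS => x /= h Ox.
rewrite -lee_fin /norm_inf fineK// unlock leb3T_gt0.
apply: le_trans h.
by rewrite patchE ifT ?inE//= abse_EFin.
Qed.

(** The bound [M] guarantees a finite essential supremum, so that the [fine] in [norm_inf] does not
    collapse it to 0. *)
Lemma norm_inf_bounded_ae g M : (forall x, Omega l x -> `|g x| <= M) ->
  {ae @leb3 R, forall x, Omega l x -> `|g x| <= norm_inf l g}.
Proof.
move=> gM; apply: norm_inf_ae; rewrite ge0_fin_numE ?Lnorm_ge0//.
rewrite unlock leb3T_gt0; apply: (@le_lt_trans _ _ `|M|%:E); last exact: ltry.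
apply/ess_supP; apply: nearW => x /=; rewrite patchE.
case: ifPn => [|_]; last by rewrite abse0 lee_fin.
by rewrite inE => /gM h; rewrite lee_fin (le_trans h)// ler_norm.
Qed.

End Space.

(** * Integrals of possibly non-measurable functions *)

Section DominatedIntegral.
Context d (T : measurableType d) (R : realType).
Variables (mu : {measure set T -> \bar R}) (D : set T).
Local Open Scope ereal_scope.

(** The integral of a nonnegative function is a supremum over the simple functions below it, hence
    monotone without measurability. Discarding the negative part of [f] reduces to that case. *)
Lemma le_integral_dom (f g : T -> \bar R) :
  (forall x, D x -> 0 <= g x) -> (forall x, D x -> f x <= g x) ->
  \int[mu]_(x in D) f x <= \int[mu]_(x in D) g x.
Proof.
move=> g0 fg; rewrite integralE.
apply: (@le_trans _ _ (\int[mu]_(x in D) (f^\+ x))).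
  rewrite -[leRHS]sube0; apply: leeB => //.
  by apply: integral_ge0 => x _; exact: funeneg_ge0.
rewrite ge0_integralE; last by move=> x _; exact: funepos_ge0.
rewrite ge0_integralE//; apply: ge_ereal_sup => _ [h /= hf <-].
apply: ereal_sup_ubound; exists h => //= x; apply: le_trans (hf x) _.
rewrite !patchE; case: ifPn => //; rewrite inE => Dx.
by rewrite funeposE ge_max g0// fg.
Qed.

Hypothesis mD : measurable D.
Variable g : T -> \bar R.
Hypotheses (g_ge0 : forall x, D x -> 0 <= g x) (mg : measurable_fun D g).

(** Raising [g] to +oo on a null set that contains the exceptional points turns the comparison into
    a pointwise one; as [g] is measurable, its integral does not change. *)
Lemma ae_le_integral_dom (f : T -> \bar R) :
  {ae mu, forall x, D x -> f x <= g x} ->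
  \int[mu]_(x in D) f x <= \int[mu]_(x in D) g x.
Proof.
move=> [N [mN N0 fgN]].
pose g' x := g x + (\1_N x)%:E * +oo.
have h0 x : 0 <= (\1_N x)%:E * +oo :> \bar R by rewrite mule_ge0 ?lee_fin.
have mh : measurable_fun D (fun x => (\1_N x)%:E * +oo : \bar R).
  apply: measurable_funTS; apply: emeasurable_funM => //.
  exact/measurable_EFinP/measurable_indic.
have -> : \int[mu]_(x in D) g x = \int[mu]_(x in D) g' x.
  apply: ge0_ae_eq_integral => //; first exact: emeasurable_funD.
    by move=> x Dx; rewrite adde_ge0// g_ge0.
  exists N; split => // x /= /not_implyP[Dx] gg'.
  apply: contrapT => Nx; apply: gg'; rewrite /g' indicE memNset// mul0e adde0.
  by [].
apply: le_integral_dom => x Dx; first by rewrite adde_ge0// g_ge0.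
have [Nx|Nx] := pselect (N x).
  rewrite /g' indicE mem_set// mul1e addey ?leey// gt_eqF//.
  by rewrite (lt_le_trans _ (g_ge0 Dx)).
rewrite /g' indicE memNset// mul0e adde0.
by apply: contrapT => fgx; apply: Nx; apply: fgN => /= /(_ Dx).
Qed.

(* [f] need not be measurable: if its integral is infinite, then
   [fine] makes the left-hand side 0. *)
Lemma ae_Rintegral_le (f : T -> R) :
  {ae mu, forall x, D x -> (f x)%:E <= g x} ->
  (\int[mu]_(x in D) f x)%R%:E <= \int[mu]_(x in D) g x.
Proof.
move=> /ae_le_integral_dom; rewrite /Rintegral.
have := @integral_ge0 _ _ _ mu D g g_ge0.
by case: (\int[mu]_(x in D) (f x)%:E).
Qed.

(** The positive and negative parts of [f] each have an integral at most that of [g]; if the latter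
    is finite, the difference of two numbers in [0, r] has absolute value at most r. *)
Lemma ae_normr_Rintegral_le (f : T -> R) :
  {ae mu, forall x, D x -> (`|f x|)%:E <= g x} ->
  (`|\int[mu]_(x in D) f x|%R)%:E <= \int[mu]_(x in D) g x.
Proof.
move=> fg; rewrite /Rintegral integralE.
set p := \int[mu]_(x in D) _; set q := \int[mu]_(x in D) _.
have p0 : 0 <= p by apply: integral_ge0 => x _; exact: funepos_ge0.
have q0 : 0 <= q by apply: integral_ge0 => x _; exact: funeneg_ge0.
have pg : p <= \int[mu]_(x in D) g x.
  apply: ae_le_integral_dom; apply: filterS fg => x fgx Dx.
  rewrite funeposE ge_max g_ge0// andbT; apply: le_trans (fgx Dx).
  by rewrite lee_fin ler_norm.
have qg : q <= \int[mu]_(x in D) g x.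
  apply: ae_le_integral_dom; apply: filterS fg => x fgx Dx.
  rewrite funenegE ge_max g_ge0// andbT; apply: le_trans (fgx Dx).
  by rewrite lee_fin -normrN ler_norm.
move: pg qg; case: (\int[mu]_(x in D) g x) => [r| |]; last 2 first.
- by move=> _ _; rewrite leey.
- by move=> /(le_trans p0).
case: p p0 => // p p0; case: q q0 => // q q0.
rewrite !lee_fin in p0 q0 * => pr qr /=.
by rewrite ler_norml; apply/andP; split; lra.
Qed.

End DominatedIntegral.

(** * Frobenius products and space-time measurability *)

Section FrobeniusProduct.
Context {R : realType} {m n : nat}.
Implicit Types (A B : 'M[R]_(m, n)) (c : R).

Lemma mxdotC A B : mxdot A B = mxdot B A.
Proof. by apply: eq_bigr => i _; apply: eq_bigr => j _; rewrite mulrC. Qed.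

Lemma mxdotDl A A' B : mxdot (A + A') B = mxdot A B + mxdot A' B.
Proof.
rewrite /mxdot -big_split; apply: eq_bigr => i _ /=.
by rewrite -big_split; apply: eq_bigr => j _ /=; rewrite mxE mulrDl.
Qed.

Lemma mxdotZl c A B : mxdot (c *: A) B = c * mxdot A B.
Proof.
rewrite /mxdot mulr_sumr; apply: eq_bigr => i _.
by rewrite mulr_sumr; apply: eq_bigr => j _; rewrite mxE mulrA.
Qed.

Lemma mxdotZr c A B : mxdot A (c *: B) = c * mxdot A B.
Proof. by rewrite mxdotC mxdotZl mxdotC. Qed.

Lemma mxdot_ge0 A : 0 <= mxdot A A.
Proof. by do 2 apply: sumr_ge0 => ? _; rewrite -expr2 sqr_ge0. Qed.

Lemma sqr_mxnorm A : mxnorm A ^+ 2 = mxdot A A.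
Proof. by rewrite sqr_sqrtr// mxdot_ge0. Qed.

Lemma mxnorm_ge0 A : 0 <= mxnorm A.
Proof. exact: sqrtr_ge0. Qed.

Lemma mxnormZ c A : mxnorm (c *: A) = `|c| * mxnorm A.
Proof.
by rewrite /mxnorm mxdotZl mxdotZr mulrA -expr2 sqrtrM ?sqr_ge0// sqrtr_sqr.
Qed.

Lemma entry_le_mxnorm A i j : A i j ^+ 2 <= mxnorm A ^+ 2.
Proof.
rewrite sqr_mxnorm /mxdot (bigD1 i)//= (bigD1 j)//= -expr2 -addrA lerDl.
rewrite addr_ge0//; first by apply: sumr_ge0 => k _; rewrite -expr2 sqr_ge0.
by do 2 apply: sumr_ge0 => ? _; rewrite -expr2 sqr_ge0.
Qed.

(** Cauchy-Schwarz by the discriminant: the quadratic |xA + B|^2 is nonnegative, and is evaluated at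
    its minimiser x = -c/a. *)
Lemma normr_mxdot_le A B : `|mxdot A B| <= mxnorm A * mxnorm B.
Proof.
rewrite -sqrtr_sqr -sqrtrM ?mxdot_ge0// ler_sqrt ?mulr_ge0 ?mxdot_ge0//.
set a := mxdot A A; set b := mxdot B B; set c := mxdot A B.
have P x : 0 <= x ^+ 2 * a + 2 * x * c + b.
  have := mxdot_ge0 (x *: A + B).
  rewrite mxdotDl mxdotZl [mxdot A (_ + _)]mxdotC [mxdot B (_ + _)]mxdotC.
  rewrite !mxdotDl !mxdotZl [mxdot B A]mxdotC -/a -/b -/c => h.
  by rewrite (le_trans h)// le_eqVlt; apply/orP; left; apply/eqP; ring.
have a0 : 0 <= a := mxdot_ge0 A.
move: a0; rewrite le_eqVlt => /predU1P[a0|a0].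
  rewrite -a0 mul0r; have [->|c0] := eqVneq c 0; first by rewrite expr0n.
  (* With a = 0 the quadratic is affine in x; this x gives it the value -1, which excludes c <>
     0. *)
  have := P (- (b + 1) / (2 * c)); rewrite -a0 mulr0 add0r.
  by rewrite (_ : 2 * _ * c = - (b + 1)); [lra|field].
have := P (- c / a).
rewrite (_ : _ + _ = (a * b - c ^+ 2) / a); last by field; rewrite gt_eqF.
by rewrite pmulr_lge0 ?invr_gt0// subr_ge0.
Qed.

End FrobeniusProduct.

Lemma mxnorm_outer (R : realType) (v : 'rV[R]_3) :
  mxnorm (v^T *m v) = mxnorm v ^+ 2.
Proof.
rewrite sqr_mxnorm -[RHS]ger0_norm ?mxdot_ge0// -sqrtr_sqr; congr Num.sqrt.
rewrite /mxdot big_ord1 expr2 mulr_suml; apply: eq_bigr => i _.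
rewrite mulr_sumr; apply: eq_bigr => j _.
by rewrite !mxE !big_ord1 !mxE; ring.
Qed.

Lemma mxdot_tr (R : realType) (A : 'M[R]_3) : \tr A = mxdot A 1%:M.
Proof.
apply: eq_bigr => i _; rewrite (bigD1 i)//= mxE eqxx mulr1 big1 ?addr0//.
by move=> j ji; rewrite mxE eq_sym (negbTE ji) mulr0.
Qed.

(** Cauchy-Schwarz against the identity, whose squared Frobenius norm is 3. *)
Lemma sqr_mxtrace_le (R : realType) (A : 'M[R]_3) :
  (\tr A) ^+ 2 <= 3 * mxnorm A ^+ 2.
Proof.
have := normr_mxdot_le A 1%:M; rewrite -mxdot_tr.
have : mxnorm (1%:M : 'M[R]_3) ^+ 2 = 3.
  by rewrite sqr_mxnorm -mxdot_tr mxtrace1.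
have := mxnorm_ge0 A; have := mxnorm_ge0 (1%:M : 'M[R]_3).
set a := mxnorm _; set b := mxnorm _ => a0 b0 a2 h.
rewrite -real_normK ?num_real// -a2 -exprMn mulrC.
by rewrite ler_pXn2r// nnegrE ?mulr_ge0.
Qed.

Section SpaceTimeMeasurability.
Context {R : realType} (l : R).
Hypothesis l_gt0 : 0 < l.

Definition spacetime : set (measurableTypeR R * R3m R) := `[0, +oo[ `*` Omega l.

Lemma measurable_spacetime : measurable spacetime.
Proof. by apply: measurableX => //; exact: measurable_Omega. Qed.

Lemma measurable_section (h : measurableTypeR R * R3m R -> R) t : 0 <= t ->
  measurable_fun spacetime h ->
  measurable_fun (Omega l) (fun x : R3m R => h (t, x)).
Proof.
move=> t0 /(measurable_restrictT _ measurable_spacetime).1 mh.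
apply: (eq_measurable_fun (fun x : R3m R => (h \_ spacetime) (t, x))).
  move=> x; rewrite inE => Ox; rewrite patchE ifT// inE; split => //=.
  by rewrite in_itv/= t0.
apply: measurable_funTS.
exact: (measurable_fun_pair2 (f := h \_ spacetime) t mh).
Qed.

(** Tonelli for the extension of [h] by 0 outside [spacetime]; for t >= 0 the section of that
    extension integrates exactly over [Omega l]. *)
Lemma measurable_integral_section (h : measurableTypeR R * R3m R -> R) :
  (forall z, 0 <= h z) -> measurable_fun spacetime h ->
  measurable_fun (`[0, +oo[ : set (measurableTypeR R))
    (fun t => \int[@leb3 R]_(x in Omega l) (h (t, x))%:E)%E.
Proof.
move=> h0 /(measurable_restrictT _ measurable_spacetime).1 mh.
pose H z : \bar R := ((h \_ spacetime) z)%:E.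
have H0 z : (0 <= H z)%E.
  by rewrite lee_fin patchE; case: ifP.
have mH : measurable_fun setT H by exact/measurable_EFinP.
have mF := @measurable_fun_fubini_tonelli_F _ _ _ _ _ (@leb3 R) H mH H0.
apply: (eq_measurable_fun (fubini_F (@leb3 R) H)); last exact: measurable_funTS.
move=> t; rewrite inE /= in_itv/= andbT => t0.
rewrite /fubini_F [RHS]integral_mkcond; apply: eq_integral => x _.
rewrite /H !patchE /spacetime; have [Ox|Ox] := boolP (x \in Omega l).
  rewrite ifT//; move: Ox; rewrite !inE => Ox; split => //=.
  by rewrite in_itv/= t0.
by rewrite ifF//; apply/negbTE; move: Ox; apply: contra; rewrite !inE => -[].
Qed.

End SpaceTimeMeasurability.

Lemma Rintegral_sum d (T : measurableType d) (R : realType)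
    (mu : {measure set T -> \bar R}) (D : set T) (I : Type) (r : seq I)
    (F : I -> T -> R) : measurable D ->
  (forall i, mu.-integrable D (EFin \o F i)) ->
  mu.-integrable D (EFin \o (fun x => \sum_(i <- r) F i x)) /\
  \int[mu]_(x in D) (\sum_(i <- r) F i x) = \sum_(i <- r) \int[mu]_(x in D) F i
    x.
Proof.
move=> mD iF; elim: r => [|i r [ih1 ih2]].
  rewrite big_nil; split.
    rewrite (_ : _ \o _ = cst 0%E); first exact: integrable0.
    by apply/funext => x /=; rewrite big_nil.
  under eq_Rintegral do rewrite big_nil.
  by rewrite Rintegral_cst// mul0r.
have E : (fun x => \sum_(j <- i :: r) F j x) =
    (fun x => F i x + \sum_(j <- r) F j x).
  by apply/funext => x; rewrite big_cons.
split.
  by rewrite E; exact: (integrableD mD (iF i) ih1).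
by rewrite big_cons -ih2 -RintegralD// E.
Qed.

(** * Integrability on the box and integration by parts against a weak gradient *)

Section SpaceIntegrals.
Context {R : realType} (l : R).
Hypothesis l_gt0 : 0 < l.

Let mO : measurable (Omega l). Proof. exact: measurable_Omega. Qed.

Lemma measurable_mxdot d (T : measurableType d) (D : set T) m n
    (A B : T -> 'M[R]_(m, n)) :
  (forall i j, measurable_fun D (fun x => A x i j)) ->
  (forall i j, measurable_fun D (fun x => B x i j)) ->
  measurable_fun D (fun x => mxdot (A x) (B x)).
Proof.
move=> mA mB; apply: measurable_sum => i; apply: measurable_sum => j.
exact: measurable_funM.
Qed.

Lemma measurable_mxtrace d (T : measurableType d) (D : set T) n
    (A : T -> 'M[R]_n) :
  (forall i j, measurable_fun D (fun x => A x i j)) ->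
  measurable_fun D (fun x => \tr (A x)).
Proof. by move=> mA; apply: measurable_sum. Qed.

(** On a box of finite volume |g| <= g^2 + 1 places L^2 inside L^1, and the continuous factor is
    bounded there. *)
Lemma integrable_sqr_mul (g b : R3 R -> R) :
  measurable_fun (Omega l) (g : R3m R -> R) -> (normsq l g < +oo)%E ->
  continuous b -> (@leb3 R).-integrable (Omega l) (EFin \o (fun x => g x * b
    x)).
Proof.
move=> mg g2 cb; have [M bM] := continuous_bounded_Omega l_gt0 cb.
have mgb : measurable_fun (Omega l) (fun x : R3m R => g x * b x).
  by apply: measurable_funM => //; exact: continuous_measurable_R3.
apply/integrableP; split; first exact/measurable_EFinP.
have mg2 : measurable_fun (Omega l) (fun x : R3m R => (g x ^+ 2)%:E).
  by apply/measurable_EFinP/measurable_funX.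
pose h (x : R3m R) : \bar R := (`|M|%:E * ((g x ^+ 2)%:E + 1%:E))%E.
apply: (@le_lt_trans _ _ (\int[@leb3 R]_(x in Omega l) h x)%E).
  apply: le_integral_dom => x Ox.
    by rewrite mule_ge0// adde_ge0// lee_fin ?sqr_ge0.
  rewrite /= lee_fin normrM mulrC; apply: ler_pM => //.
    by rewrite (le_trans (bM _ Ox))// ler_norm.
  rewrite -[g x ^+ 2]real_normK ?num_real//.
  by have := sqr_ge0 (`|g x| - 1); have := normr_ge0 (g x); nra.
rewrite /h ge0_integralZl_EFin//; last 2 first.
- by move=> x _; rewrite adde_ge0// lee_fin sqr_ge0.
- exact: emeasurable_funD.
rewrite ge0_integralD//; last by move=> x _; rewrite lee_fin sqr_ge0.
rewrite lte_mul_pinfty// lte_add_pinfty//.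
rewrite integral_cst// mul1e (_ : _ (Omega l) = (vol l)%:E) ?ltry//.
exact: leb3_Omega.
Qed.

Lemma normsq_entry_lt m n (A : R3 R -> 'M[R]_(m, n)) i j :
  (normsq l (fun x => mxnorm (A x)) < +oo)%E ->
  (normsq l (fun x => A x i j) < +oo)%E.
Proof.
move=> A2; apply: le_lt_trans A2; apply: le_integral_dom => x _.
  by rewrite lee_fin sqr_ge0.
by rewrite lee_fin entry_le_mxnorm.
Qed.

Lemma partial_periodic j (g : R3 R -> R) :
  space_periodic l g -> space_periodic l (partial j g).
Proof.
move=> pg k x; rewrite /partial /derive.
apply: (congr1 (fun F : R -> R => lim (F @ 0^'))); apply/funext => h /=;
  rewrite pg.
by rewrite addrA pg.
Qed.

(** Each first partial of [g] is again smooth and periodic, hence a test function for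
    [weak_gradient]. The L^2 bounds make every product integrable, so that the double sums leave the
    integral. *)
Lemma inner_laplacian (v g : R3 R -> 'rV[R]_3) (G : R3 R -> 'M[R]_3) :
  (forall i, measurable_fun (Omega l) (fun x : R3m R => v x 0 i)) ->
  (forall i j, measurable_fun (Omega l) (fun x : R3m R => G x i j)) ->
  (normsq l (fun x => mxnorm (v x)) < +oo)%E ->
  (normsq l (fun x => mxnorm (G x)) < +oo)%E ->
  weak_gradient l v G -> smooth_field g -> space_periodic l g ->
  inner l v (laplacian g) = - inner l G (grad g).
Proof.
move=> mv mG v2 G2 vG sg pg.
pose P k j : R3 R -> R := partial j (fun x => g x 0 k).
have sP k j : smooth (P k j) by exact: smooth_partial.
have iv k j : (@leb3 R).-integrable (Omega l)
    (EFin \o (fun x => v x 0 k * partial j (P k j) x)).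
  apply: integrable_sqr_mul => //; first exact: normsq_entry_lt.
  exact/smooth_continuous/smooth_partial.
have iG k j : (@leb3 R).-integrable (Omega l)
    (EFin \o (fun x => G x k j * P k j x)).
  apply: integrable_sqr_mul => //; first exact: normsq_entry_lt.
  exact/smooth_continuous.
have ivS k := Rintegral_sum (index_enum 'I_3) mO (iv k).
have iGS k := Rintegral_sum (index_enum 'I_3) mO (iG k).
transitivity (\sum_(k < 3) \sum_(j < 3)
    \int[@leb3 R]_(x in Omega l) (v x 0 k * partial j (P k j) x)).
  transitivity (\int[@leb3 R]_(x in Omega l)
      (\sum_(k < 3) \sum_(j < 3) (v x 0 k * partial j (P k j) x))).
    apply: eq_Rintegral => x _; rewrite /mxdot big_ord1.
    by apply: eq_bigr => k _; rewrite mxE mulr_sumr.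
  rewrite (Rintegral_sum (index_enum 'I_3) mO (fun k => (ivS k).1)).2.
  by apply: eq_bigr => k _; rewrite (ivS k).2.
transitivity (- \sum_(k < 3) \sum_(j < 3)
    \int[@leb3 R]_(x in Omega l) (G x k j * P k j x)).
  rewrite -sumrN; apply: eq_bigr => k _; rewrite -sumrN.
  apply: eq_bigr => j _; rewrite -vG//.
  by apply: partial_periodic => i x; rewrite pg.
congr (- _); transitivity (\int[@leb3 R]_(x in Omega l)
      (\sum_(k < 3) \sum_(j < 3) (G x k j * P k j x))); last first.
  apply: eq_Rintegral => x _; apply: eq_bigr => k _; apply: eq_bigr => j _.
  by rewrite mxE.
rewrite (Rintegral_sum (index_enum 'I_3) mO (fun k => (iGS k).1)).2.
by apply: eq_bigr => k _; rewrite (iGS k).2.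
Qed.

End SpaceIntegrals.

Section FieldNorms.
Context {R : realType}.

Lemma continuous_sum_ord (T : topologicalType) n (F : 'I_n -> T -> R) :
  (forall i, continuous (F i)) -> continuous (fun x => \sum_i F i x).
Proof.
move=> cF; elim: (index_enum _) => [|i r ih].
  by under eq_fun do rewrite big_nil; move=> x; exact: cvg_cst.
under eq_fun do rewrite big_cons.
by move=> x; apply: cvgD; [exact: cF|exact: ih].
Qed.

Lemma continuous_mxnorm (T : topologicalType) m n (A : T -> 'M[R]_(m, n)) :
  (forall i j, continuous (fun x => A x i j)) -> continuous (fun x => mxnorm (A
    x)).
Proof.
move=> cA x; apply: (@continuous_comp _ _ _ (fun y => mxdot (A y) (A y))
  Num.sqrt);
  last exact: sqrt_continuous.
apply: continuous_sum_ord => i; apply: continuous_sum_ord => j y.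
by apply: cvgM; exact: cA.
Qed.

Lemma measurable_mxnorm d (T : measurableType d) (D : set T) m n
    (A : T -> 'M[R]_(m, n)) :
  (forall i j, measurable_fun D (fun x => A x i j)) ->
  measurable_fun D (fun x => mxnorm (A x)).
Proof.
move=> mA; have mdA := measurable_mxdot mA mA.
apply: (@measurableT_comp _ _ _ _ _ _ (@Num.sqrt R : measurableTypeR R ->
  measurableTypeR R)) mdA.
by apply: continuous_measurable_fun; exact: sqrt_continuous.
Qed.

Variable l : R.
Hypothesis l_gt0 : 0 < l.
Let mO : measurable (Omega l). Proof. exact: measurable_Omega. Qed.

Lemma normsq_ge0 (g : R3 R -> R) : (0 <= normsq l g)%E.
Proof. by apply: integral_ge0 => x _; rewrite lee_fin sqr_ge0. Qed.

Lemma normsq_continuous (g : R3 R -> R) : continuous g ->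
  normsq l g = (fine (normsq l g))%:E.
Proof.
move=> cg; rewrite fineK// ge0_fin_numE ?normsq_ge0//.
have [M gM] := continuous_bounded_Omega l_gt0 cg.
apply: (@le_lt_trans _ _ (\int[@leb3 R]_(x in Omega l) (cst (M ^+ 2)%:E) x)%E).
  apply: le_integral_dom => x Ox; first by rewrite lee_fin sqr_ge0.
  by rewrite lee_fin -[g x ^+ 2]real_normK ?num_real// lerXn2r ?nnegrE ?gM//
    (le_trans _ (gM _ Ox)).
rewrite integral_cst// (_ : _ (Omega l) = (vol l)%:E) ?ltry//.
exact: leb3_Omega.
Qed.

Lemma normsq_comb (g1 g2 : R3 R -> R) a b : 0 <= a -> 0 <= b ->
  measurable_fun (Omega l) (g1 : R3m R -> R) ->
  measurable_fun (Omega l) (g2 : R3m R -> R) ->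
  (\int[@leb3 R]_(x in Omega l) (a * g1 x ^+ 2 + b * g2 x ^+ 2)%:E
   = a%:E * normsq l g1 + b%:E * normsq l g2)%E.
Proof.
move=> a0 b0 mg1 mg2.
have m1 : measurable_fun (Omega l) (fun x : R3m R => (g1 x ^+ 2)%:E).
  exact/measurable_EFinP/measurable_funX.
have m2 : measurable_fun (Omega l) (fun x : R3m R => (g2 x ^+ 2)%:E).
  exact/measurable_EFinP/measurable_funX.
rewrite /normsq -!ge0_integralZl_EFin//; try by move=> x _; rewrite lee_fin
  sqr_ge0.
rewrite -ge0_integralD//; try by move=> x _; rewrite mule_ge0 ?lee_fin ?sqr_ge0.
- exact: measurable_funeM.
- exact: measurable_funeM.
Qed.

(** Common frame of all Young estimates below. Measurability is asked of the majorants [g1] and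
    [g2], and the right-hand side may be +oo. *)
Lemma normr_inner_le m n (v w : R3 R -> 'M[R]_(m, n)) (g1 g2 : R3 R -> R) a b :
  0 <= a -> 0 <= b ->
  measurable_fun (Omega l) (g1 : R3m R -> R) ->
  measurable_fun (Omega l) (g2 : R3m R -> R) ->
  {ae @leb3 R, forall x, Omega l x ->
    `|mxdot (v x) (w x)| <= a * g1 x ^+ 2 + b * g2 x ^+ 2} ->
  (`|inner l v w|%:E <= a%:E * normsq l g1 + b%:E * normsq l g2)%E.
Proof.
move=> a0 b0 mg1 mg2 h; rewrite -normsq_comb//.
apply: ae_normr_Rintegral_le => //.
- by move=> x _; rewrite lee_fin addr_ge0// mulr_ge0 ?sqr_ge0.
- apply/measurable_EFinP; apply: measurable_funD; apply: measurable_funM => //;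
  exact: measurable_funX.
Qed.

Lemma inner0r m n (v w : R3 R -> 'M[R]_(m, n)) : (forall x, w x = 0) ->
  inner l v w = 0.
Proof.
move=> w0; transitivity (\int[@leb3 R]_(x in Omega l) (0 : R)).
  apply: eq_Rintegral => x _.
  by rewrite w0 -(scale0r (0 : 'M[R]_(m, n))) mxdotZr mul0r.
by rewrite Rintegral_cst// mul0r.
Qed.

End FieldNorms.

(** * Energy and momentum balances over a finite time *)

Section Trajectory.
Context {R : realType} (nu gamma l : R).
Variables (f : R3 R -> 'rV[R]_3) (u : R -> R3 R -> 'rV[R]_3)
  (Du : R -> R3 R -> 'M[R]_3).
Hypotheses (nu_gt0 : 0 < nu) (gamma_gt0 : 0 < gamma) (l_gt0 : 0 < l).
Hypotheses (f_smooth : smooth_field f) (f_per : space_periodic l f)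
  (f_div : forall x, div f x = 0).
Hypothesis u_class : energy_class l u Du.

Let mO : measurable (Omega l). Proof. exact: measurable_Omega. Qed.

(** Names are up to normalisation: [kinetic] is twice the kinetic energy, and [enstrophy] uses the
    whole gradient rather than the curl. None of the four quantities is divided by the volume. *)
Definition kinetic (t : R) : \bar R := normsq l (fun x => mxnorm (u t x)).
Definition enstrophy (t : R) : \bar R := normsq l (fun x => mxnorm (Du t x)).
Definition compression (t : R) : \bar R := normsq l (fun x => \tr (Du t x)).
Definition power (t : R) : \bar R :=
  (nu%:E * enstrophy t + gamma%:E * compression t)%E.

Lemma measurable_velocity t i : 0 <= t ->
  measurable_fun (Omega l) (fun x : R3m R => u t x 0 i).
Proof.
move=> t0; have [mu _ _ _] := u_class.
exact: (measurable_section (h := fun z => u z.1 z.2 0 i) t0 (mu i)).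
Qed.

Lemma measurable_gradient t i j : 0 <= t ->
  measurable_fun (Omega l) (fun x : R3m R => Du t x i j).
Proof.
move=> t0; have [_ mDu _ _] := u_class.
exact: (measurable_section (h := fun z => Du z.1 z.2 i j) t0 (mDu i j)).
Qed.

Lemma measurable_speed t : 0 <= t ->
  measurable_fun (Omega l) (fun x : R3m R => mxnorm (u t x)).
Proof.
move=> t0; apply: measurable_mxnorm => i j.
by rewrite (ord1 i); exact: measurable_velocity.
Qed.

Lemma measurable_gradient_norm t : 0 <= t ->
  measurable_fun (Omega l) (fun x : R3m R => mxnorm (Du t x)).
Proof.
by move=> t0; apply: measurable_mxnorm => i j; exact: measurable_gradient.
Qed.

Lemma measurable_divergence t : 0 <= t ->
  measurable_fun (Omega l) (fun x : R3m R => \tr (Du t x)).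
Proof.
by move=> t0; apply: measurable_mxtrace => i j; exact: measurable_gradient.
Qed.

Local Notation half_line := (`[0, +oo[%classic : set (measurableTypeR R)).

Lemma measurable_kinetic : measurable_fun half_line kinetic.
Proof.
have [mu _ _ _] := u_class.
apply: (measurable_integral_section
  (h := fun z => mxnorm (u z.1 z.2) ^+ 2)) => [z|]; first exact: sqr_ge0.
apply: measurable_funX; apply: measurable_mxnorm => i j.
by rewrite (ord1 i); exact: mu.
Qed.

Lemma measurable_enstrophy : measurable_fun half_line enstrophy.
Proof.
have [_ mDu _ _] := u_class.
apply: (measurable_integral_section
  (h := fun z => mxnorm (Du z.1 z.2) ^+ 2)) => [z|]; first exact: sqr_ge0.
by apply: measurable_funX; apply: measurable_mxnorm.
Qed.

Lemma measurable_compression : measurable_fun half_line compression.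
Proof.
have [_ mDu _ _] := u_class.
apply: (measurable_integral_section
  (h := fun z => (\tr (Du z.1 z.2)) ^+ 2)) => [z|]; first exact: sqr_ge0.
by apply: measurable_funX; apply: measurable_mxtrace.
Qed.

Lemma kinetic_ge0 t : (0 <= kinetic t)%E.
Proof. exact: normsq_ge0. Qed.

Lemma enstrophy_ge0 t : (0 <= enstrophy t)%E.
Proof. exact: normsq_ge0. Qed.

Lemma compression_ge0 t : (0 <= compression t)%E.
Proof. exact: normsq_ge0. Qed.

Lemma power_ge0 t : (0 <= power t)%E.
Proof.
by rewrite adde_ge0// mule_ge0 ?lee_fin ?normsq_ge0// ltW.
Qed.

Lemma measurable_power : measurable_fun half_line power.
Proof.
apply: emeasurable_funD; apply: measurable_funeM.
- exact: measurable_enstrophy.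
- exact: measurable_compression.
Qed.

(** [energy_class] controls the full gradient only; this bound carries finiteness over to the
    divergence, and thus to [power]. *)
Lemma compression_le t : 0 <= t -> (compression t <= 3%:E * enstrophy t)%E.
Proof.
move=> t0; rewrite /enstrophy /normsq -ge0_integralZl_EFin//; last 2 first.
- by move=> x _; rewrite lee_fin sqr_ge0.
- by apply/measurable_EFinP/measurable_funX; exact: measurable_gradient_norm.
apply: le_integral_dom => x _; first by rewrite mule_ge0 ?lee_fin ?sqr_ge0.
by rewrite lee_fin sqr_mxtrace_le.
Qed.

Lemma sub_half_line (T : R) : (`[0, T]%classic : set R) `<=` `[0, +oo[%classic.
Proof. by move=> t; rewrite /= !in_itv/= => /andP[->]. Qed.

Lemma integral_kinetic_lty T : 0 < T ->
  (\int[@lebesgue_measure R]_(t in `[0%R, T]) kinetic t < +oo)%E.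
Proof.
move=> T0; have [_ _ /(_ T T0) h _] := u_class.
apply: le_lt_trans h; apply: le_integral_dom => t _.
  by rewrite adde_ge0 ?normsq_ge0.
by rewrite leeDl ?normsq_ge0.
Qed.

Lemma integral_power_lty T : 0 < T ->
  (\int[@lebesgue_measure R]_(t in `[0%R, T]) power t < +oo)%E.
Proof.
move=> T0; have [_ _ /(_ T T0) h _] := u_class.
pose c := nu + gamma * 3.
have c0 : 0 <= c by rewrite addr_ge0 ?mulr_ge0// ltW.
have mI : measurable (`[0, T]%classic : set (measurableTypeR R)).
  exact: measurable_itv.
apply: (@le_lt_trans _ _ (c%:E *
   \int[@lebesgue_measure R]_(t in `[0%R, T]) (kinetic t + enstrophy t))%E);
     last first.
  exact: lte_mul_pinfty.
rewrite -ge0_integralZl_EFin//; last 2 first.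
- by move=> t _; rewrite adde_ge0 ?normsq_ge0.
- apply: (measurable_funS _ (@sub_half_line T)) => //.
  apply: emeasurable_funD; first exact: measurable_kinetic.
  exact: measurable_enstrophy.
apply: le_integral_dom => t.
  by rewrite mule_ge0 ?lee_fin// adde_ge0 ?normsq_ge0.
rewrite /= in_itv/= => /andP[t0 _].
apply: (@le_trans _ _ (c%:E * enstrophy t)%E).
  have [nu0 ga0] := (ltW nu_gt0, ltW gamma_gt0).
  rewrite /power /c EFinD ge0_muleDl ?lee_fin ?mulr_ge0//.
  rewrite leeD2l// EFinM -muleA lee_wpmul2l ?lee_fin//.
  exact: compression_le.
by rewrite lee_wpmul2l ?lee_fin// leeDr ?normsq_ge0.
Qed.

Definition total_kinetic (T : R) : R :=
  fine (\int[@lebesgue_measure R]_(t in `[0%R, T]) kinetic t)%E.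
Definition total_power (T : R) : R :=
  fine (\int[@lebesgue_measure R]_(t in `[0%R, T]) power t)%E.

Lemma total_kineticE T : 0 < T ->
  (\int[@lebesgue_measure R]_(t in `[0%R, T]) kinetic t)%E
  = (total_kinetic T)%:E.
Proof.
move=> T0; rewrite fineK// ge0_fin_numE ?integral_kinetic_lty//.
by apply: integral_ge0 => t _; exact: kinetic_ge0.
Qed.

Lemma total_powerE T : 0 < T ->
  (\int[@lebesgue_measure R]_(t in `[0%R, T]) power t)%E
  = (total_power T)%:E.
Proof.
move=> T0; rewrite fineK// ge0_fin_numE ?integral_power_lty//.
by apply: integral_ge0 => t _; exact: power_ge0.
Qed.

Lemma total_kinetic_ge0 T : 0 <= total_kinetic T.
Proof. by apply: fine_ge0; apply: integral_ge0 => t _; exact: kinetic_ge0. Qed.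

Lemma integral_comb (a b c T : R) : 0 <= a -> 0 <= b -> 0 <= c -> 0 < T ->
  (\int[@lebesgue_measure R]_(t in `[0%R, T])
      (a%:E + b%:E * kinetic t + c%:E * power t)
   = (a * T + b * total_kinetic T + c * total_power T)%:E)%E.
Proof.
move=> a0 b0 c0 T0.
have mI : measurable (`[0, T]%classic : set (measurableTypeR R)).
  exact: measurable_itv.
have mk : measurable_fun (`[0, T]%classic : set (measurableTypeR R)) kinetic.
  by apply: (measurable_funS _ (@sub_half_line T)) => //; exact:
    measurable_kinetic.
have mp : measurable_fun (`[0, T]%classic : set (measurableTypeR R)) power.
  by apply: (measurable_funS _ (@sub_half_line T)) => //; exact:
    measurable_power.
rewrite ge0_integralD//; last 4 first.
- by move=> t _; rewrite adde_ge0 ?lee_fin// mule_ge0 ?lee_fin ?kinetic_ge0.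
- by apply: emeasurable_funD => //; exact: measurable_funeM.
- by move=> t _; rewrite mule_ge0 ?lee_fin ?power_ge0.
- exact: measurable_funeM.
rewrite ge0_integralD//; last 2 first.
- by move=> t _; rewrite mule_ge0 ?lee_fin ?kinetic_ge0.
- exact: measurable_funeM.
rewrite !ge0_integralZl_EFin//; try by move=> t _; rewrite ?kinetic_ge0
  ?power_ge0.
rewrite total_kineticE// total_powerE// integral_cst//= lebesgue_measure_itv/=.
by rewrite lte_fin T0 oppr0 adde0 -!EFinM -!EFinD.
Qed.

End Trajectory.

(** * Bounds at a fixed time for the terms of the equation tested against a multiple of f *)

Section Forcing.
Context {R : realType} (nu gamma l : R).
Variables (f : R3 R -> 'rV[R]_3) (u : R -> R3 R -> 'rV[R]_3)
  (Du : R -> R3 R -> 'M[R]_3).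
Hypotheses (nu_gt0 : 0 < nu) (gamma_gt0 : 0 < gamma) (l_gt0 : 0 < l).
Hypotheses (f_smooth : smooth_field f) (f_per : space_periodic l f)
  (f_div : forall x, div f x = 0).
Hypothesis u_class : energy_class l u Du.

Local Notation A := (fine (normsq l (fun x => mxnorm (f x)))).
Local Notation B := (fine (normsq l (fun x => mxnorm (grad f x)))).
Local Notation k := (norm_inf l (fun x => mxnorm (f x))).
Local Notation m := (norm_inf l (fun x => mxnorm (grad f x))).

Lemma continuous_norm_force : continuous (fun x => mxnorm (f x)).
Proof.
apply: continuous_mxnorm => i j; rewrite (ord1 i).
exact: smooth_continuous.
Qed.

Lemma continuous_norm_grad_force : continuous (fun x => mxnorm (grad f x)).
Proof.
apply: continuous_mxnorm => i j.
under eq_fun do rewrite mxE.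
exact/smooth_continuous/smooth_partial.
Qed.

Lemma measurable_norm_force :
  measurable_fun (Omega l) (fun x : R3m R => mxnorm (f x)).
Proof.
exact: (continuous_measurable_R3 (g := fun x => mxnorm (f x))
  continuous_norm_force).
Qed.

Lemma measurable_norm_grad_force :
  measurable_fun (Omega l) (fun x : R3m R => mxnorm (grad f x)).
Proof.
exact: (continuous_measurable_R3 (g := fun x => mxnorm (grad f x))
  continuous_norm_grad_force).
Qed.

Lemma force_ae : {ae @leb3 R, forall x, Omega l x -> mxnorm (f x) <= k}.
Proof.
have [M fM] := continuous_bounded_Omega l_gt0 continuous_norm_force.
apply: filterS (norm_inf_bounded_ae l_gt0 fM) => x h Ox.
by rewrite (le_trans _ (h Ox))// ler_norm.
Qed.

Lemma grad_force_ae :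
  {ae @leb3 R, forall x, Omega l x -> mxnorm (grad f x) <= m}.
Proof.
have [M fM] := continuous_bounded_Omega l_gt0 continuous_norm_grad_force.
apply: filterS (norm_inf_bounded_ae l_gt0 fM) => x h Ox.
by rewrite (le_trans _ (h Ox))// ler_norm.
Qed.

Lemma normsq_force : normsq l (fun x => mxnorm (f x)) = A%:E.
Proof. exact/normsq_continuous/continuous_norm_force. Qed.

Lemma normsq_grad_force : normsq l (fun x => mxnorm (grad f x)) = B%:E.
Proof. exact/normsq_continuous/continuous_norm_grad_force. Qed.

Lemma inner_force : inner l f f = A.
Proof.
rewrite /inner /Rintegral /normsq; congr fine; apply: eq_integral => x _.
by rewrite sqr_mxnorm.
Qed.

Section Instant.
Variables (s c th th' t : R).
Hypotheses (s_gt0 : 0 < s) (c_gt0 : 0 < c) (th01 : 0 <= th <= 1)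
  (th'_le : `|th'| <= c) (t_ge0 : 0 <= t).

(** Equal Young weights suffice, because [c] will be the slope bound 2n/T of the cutoff and both
    terms vanish in the time average. *)
Lemma acceleration_term_le :
  (`|inner l (u t) (fun x => th' *: f x)|%:E
   <= (c / 2)%:E * kinetic l u t + (c / 2)%:E * A%:E)%E.
Proof.
have c2 : 0 <= c / 2 by rewrite divr_ge0// ltW.
rewrite -normsq_force; apply: normr_inner_le => //.
- exact: (measurable_speed u_class t_ge0).
- exact: measurable_norm_force.
apply: nearW => x _; apply: le_trans (normr_mxdot_le _ _) _.
rewrite mxnormZ mulrCA.
have := mxnorm_ge0 (u t x); have := mxnorm_ge0 (f x).
set a := mxnorm (f x); set b := mxnorm (u t x) => a0 b0.
have := sqr_ge0 (a - b) => h.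
have ab : 0 <= b * a by rewrite mulr_ge0.
apply: le_trans (ler_wpM2r ab th'_le) _; nra.
Qed.

(** The outer product has Frobenius norm |u|^2, already at the limit of integrability, so the
    gradient of the force has to be taken in sup norm. This accounts for the sup norm in
    [L_scale]. *)
Lemma convection_term_le :
  (`|inner l (fun x => (u t x)^T *m u t x) (grad (fun x => th *: f x))|%:E
   <= m%:E * kinetic l u t)%E.
Proof.
have -> : (m%:E * kinetic l u t)%E = (m%:E * kinetic l u t + 0%:E * kinetic l u
  t)%E.
  by rewrite mul0e adde0.
have mu := measurable_speed u_class t_ge0.
apply: normr_inner_le => //; first exact: norm_inf_ge0.
apply: filterS grad_force_ae => x h Ox; rewrite mul0r addr0.
apply: le_trans (normr_mxdot_le _ _) _.
rewrite gradZ// mxnormZ mxnorm_outer mulrC ler_wpM2r ?sqr_ge0//.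
apply: le_trans (h Ox); have /andP[th0 th1] := th01.
by rewrite ger0_norm// ler_piMl// mxnorm_ge0.
Qed.

(** A completed square. The weight gamma/s is halved by the coefficient 1/2 of the equation, leaving
    gamma/(2s), the same share as in the viscous term; the sup norm of f produces [kappa] later. *)
Lemma compression_term_le :
  (`|inner l (fun x => \tr (Du t x) *: u t x) (fun x => th *: f x)|%:E
   <= (gamma / s)%:E * compression l Du t
      + (s * k ^+ 2 / (4 * gamma))%:E * kinetic l u t)%E.
Proof.
have k0 : 0 <= k by exact: norm_inf_ge0.
apply: normr_inner_le.
- by rewrite divr_ge0// ltW.
- by rewrite divr_ge0 ?mulr_ge0 ?sqr_ge0// ltW.
- exact: (measurable_divergence u_class t_ge0).
- exact: (measurable_speed u_class t_ge0).
apply: filterS force_ae => x h Ox.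
have thf : `|th| * mxnorm (f x) <= k.
  apply: le_trans (h Ox); have /andP[th0 th1] := th01.
  by rewrite ger0_norm// ler_piMl// mxnorm_ge0.
rewrite mxdotZl normrM.
apply: (@le_trans _ _ (`|\tr (Du t x)| * (mxnorm (u t x) * k))).
  rewrite ler_wpM2l//; apply: le_trans (normr_mxdot_le _ _) _.
  by rewrite mxnormZ ler_wpM2l// mxnorm_ge0.
rewrite -[\tr (Du t x) ^+ 2]real_normK ?num_real//.
set a := `|_|; set b := mxnorm _; rewrite -subr_ge0.
rewrite (_ : _ - _ = (gamma / s) * (a - s * k * b / (2 * gamma)) ^+ 2).
  by rewrite mulr_ge0 ?sqr_ge0 ?divr_ge0 ?ltW.
by field; rewrite !gt_eqF.
Qed.

(** One integration by parts leaves a single derivative on f, measured in L^2: the source of the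
    third entry of [L_scale]. The rest is a completed square. *)
Lemma viscous_term_le : (kinetic l u t < +oo)%E -> (enstrophy l Du t < +oo)%E ->
  weak_gradient l (u t) (Du t) ->
  (`|inner l (u t) (laplacian (fun x => th *: f x))|%:E
   <= ((2 * s)^-1)%:E * enstrophy l Du t + (s / 2)%:E * B%:E)%E.
Proof.
move=> u2 Du2 wg.
rewrite (@inner_laplacian _ _ l_gt0 _ _ (Du t))//; last 4 first.
- by move=> i; exact: (measurable_velocity u_class i t_ge0).
- by move=> i j; exact: (measurable_gradient u_class i j t_ge0).
- move=> i; apply/smoothP => n; under eq_fun do rewrite mxE.
  apply: smooth_uptoM; first exact: smooth_upto_cst.
  by move/smoothP : (f_smooth i).
- by move=> j x; rewrite f_per.
rewrite normrN -normsq_grad_force; apply: normr_inner_le.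
- by rewrite invr_ge0 mulr_ge0// ltW.
- by rewrite divr_ge0// ltW.
- exact: (measurable_gradient_norm u_class t_ge0).
- exact: measurable_norm_grad_force.
apply: nearW => x _; apply: le_trans (normr_mxdot_le _ _) _.
rewrite gradZ// mxnormZ.
set a := mxnorm (Du t x); set b := mxnorm (grad f x).
have [a0 b0] : 0 <= a /\ 0 <= b by split; exact: mxnorm_ge0.
apply: (@le_trans _ _ (a * b)).
  have /andP[th0 th1] := th01.
  by rewrite ger0_norm// ler_wpM2l// ler_piMl.
rewrite -subr_ge0 (_ : _ - _ = (a - s * b) ^+ 2 / (2 * s)).
  by rewrite divr_ge0 ?sqr_ge0// mulr_ge0// ltW.
by field; rewrite gt_eqF.
Qed.

End Instant.
End Forcing.

Section Balance.
Context {R : realType} (nu gamma l : R).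
Variables (f : R3 R -> 'rV[R]_3) (u : R -> R3 R -> 'rV[R]_3)
  (Du : R -> R3 R -> 'M[R]_3).
Hypotheses (nu_gt0 : 0 < nu) (gamma_gt0 : 0 < gamma) (l_gt0 : 0 < l).
Hypotheses (f_smooth : smooth_field f) (f_per : space_periodic l f)
  (f_div : forall x, div f x = 0).
Hypothesis u_class : energy_class l u Du.

Local Notation A := (fine (normsq l (fun x => mxnorm (f x)))).
Local Notation B := (fine (normsq l (fun x => mxnorm (grad f x)))).
Local Notation k := (norm_inf l (fun x => mxnorm (f x))).
Local Notation m := (norm_inf l (fun x => mxnorm (grad f x))).
Local Notation N := (kinetic l u).
Local Notation P := (power nu gamma l Du).

Lemma A_ge0 : 0 <= A. Proof. by rewrite fine_ge0// normsq_ge0. Qed.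
Lemma B_ge0 : 0 <= B. Proof. by rewrite fine_ge0// normsq_ge0. Qed.

(** The time integrand of [distributional_solution] for theta(t) f, with the values of theta and
    theta' at time [t] frozen into numbers, so that it can be bounded one time at a time. *)
Definition weak_integrand (th th' t : R) : R :=
  - inner l (u t) (fun x => th' *: f x)
  - inner l (fun x => (u t x)^T *m u t x) (grad (fun x => th *: f x))
  - 2^-1 * inner l (fun x => \tr (Du t x) *: u t x) (fun x => th *: f x)
  - nu * inner l (u t) (laplacian (fun x => th *: f x))
  - gamma * inner l (u t) (grad_div (fun x => th *: f x)).

Lemma grad_div_scale_eq0 th t :
  inner l (u t) (grad_div (fun x => th *: f x)) = 0.
Proof.
apply: inner0r => x; apply: grad_div_eq0 => y.
by rewrite divZ// f_div mulr0.
Qed.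

(** The Young weights of the viscous and compression terms were chosen so that their gradient parts
    add up to exactly (2s)^-1 [P t]. *)
Lemma weak_integrand_le (s c th th' t : R) : 0 < s -> 0 < c ->
  0 <= th <= 1 -> `|th'| <= c -> 0 <= t -> weak_gradient l (u t) (Du t) ->
  ((weak_integrand th th' t)%:E <=
   (c / 2 * A + nu * s / 2 * B)%:E
   + (c / 2 + m + s * k ^+ 2 / (8 * gamma))%:E * N t
   + ((2 * s)^-1)%:E * P t)%E.
Proof.
move=> s0 c0 th01 th'c t0 wg.
have A0 := A_ge0; have B0 := B_ge0.
have [nu0 ga0 s0' c0'] :
  [/\ 0 <= nu, 0 <= gamma, 0 <= s & 0 <= c] by split; exact: ltW.
have c10 : 0 <= c / 2 * A + nu * s / 2 * B.
  by rewrite addr_ge0// mulr_ge0// divr_ge0// mulr_ge0.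
(* Strict positivity matters: at times where [N t] is +oo the right-hand side is then +oo and the
   bound is trivial. *)
have c20 : 0 < c / 2 + m + s * k ^+ 2 / (8 * gamma).
  rewrite ltr_wpDr//; last by rewrite ltr_wpDr ?divr_gt0// norm_inf_ge0.
  by rewrite divr_ge0// mulr_ge0// sqr_ge0.
have c30 : 0 < (2 * s)^-1 by rewrite invr_gt0 mulr_gt0.
have c30E : (0 <= ((2 * s)^-1)%:E :> \bar R)%E by rewrite lee_fin ltW.
have gaE : (0 <= gamma%:E :> \bar R)%E by rewrite lee_fin.
have := acceleration_term_le l_gt0 f_smooth u_class c0 th'c t0.
have := convection_term_le l_gt0 f_smooth u_class th01 t0.
have := compression_term_le gamma_gt0 l_gt0 f_smooth u_class s0 th01 t0.
have := viscous_term_le l_gt0 f_smooth f_per u_class s0 th01 t0.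
have := power_ge0 l Du nu_gt0 gamma_gt0 t; have := kinetic_ge0 l u t.
have := enstrophy_ge0 l Du t; have := compression_ge0 l Du t.
have := compression_le u_class t0; rewrite /power.
case: (kinetic l u t) => [n| |]//; last first.
  move=> _ _ _ _ p0 *; rewrite gt0_muley ?lte_fin// addey// addye ?leey//.
  by rewrite gt_eqF// (lt_le_trans _ (mule_ge0 c30E p0)).
case: (enstrophy l Du t) => [e| |]//; last first.
  move=> _ z0 _ n0 p0 *; rewrite gt0_muley ?lte_fin// addye; last first.
    by rewrite gt_eqF// (lt_le_trans _ (mule_ge0 gaE z0)).
  by rewrite gt0_muley ?lte_fin// addey ?leey.
(* [compression_le] rules out an infinite compression once the enstrophy is finite. *)
case: (compression l Du t) => [z| |]// _ z0 e0 n0 _.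
rewrite !lee_fin in z0 e0 n0.
move=> /(_ (ltry _) (ltry _) wg).
rewrite !lee_fin /weak_integrand grad_div_scale_eq0 mulr0 subr0.
move: (inner _ _ _) (inner _ _ _) (inner _ _ _) (inner _ _ _) => i1 i2 i3 i4.
rewrite !ler_norml => /andP[h1 _] /andP[h2 _] /andP[h3 _] /andP[h4 _].
have h1' : - (nu * i4) <= nu * ((2 * s)^-1 * e + s / 2 * B).
  by rewrite -mulrN ler_pM2l// lerNl.
apply: (@le_trans _ _ ((c / 2 * n + c / 2 * A) + m * n
   + 2^-1 * (gamma / s * z + s * k ^+ 2 / (4 * gamma) * n)
   + nu * ((2 * s)^-1 * e + s / 2 * B))); first lra.
rewrite le_eqVlt; apply/orP; left; apply/eqP; field.
by rewrite !gt_eqF.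
Qed.

End Balance.

(** * The energy and momentum balances integrated over [0, T] *)

Section Balances.
Context {R : realType} (nu gamma l : R).
Variables (f u0 : R3 R -> 'rV[R]_3) (u : R -> R3 R -> 'rV[R]_3)
  (Du : R -> R3 R -> 'M[R]_3).
Hypotheses (nu_gt0 : 0 < nu) (gamma_gt0 : 0 < gamma) (l_gt0 : 0 < l).
Hypotheses (f_smooth : smooth_field f) (f_per : space_periodic l f)
  (f_div : forall x, div f x = 0).
Hypothesis u0_meas :
  forall i, measurable_fun (Omega l) (fun x : R3m R => u0 x 0 i).
Hypothesis u0_L2 : (normsq l (fun x => mxnorm (u0 x)) < +oo)%E.
Hypothesis u_sol : weak_solution l nu gamma f u0 u Du.

Let u_class : energy_class l u Du. Proof. by have [] := u_sol. Qed.
Let mO : measurable (Omega l). Proof. exact: measurable_Omega. Qed.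

Local Notation A := (fine (normsq l (fun x => mxnorm (f x)))).
Local Notation B := (fine (normsq l (fun x => mxnorm (grad f x)))).
Local Notation k := (norm_inf l (fun x => mxnorm (f x))).
Local Notation m := (norm_inf l (fun x => mxnorm (grad f x))).
Local Notation N := (kinetic l u).
Local Notation P := (power nu gamma l Du).
Local Notation W := (total_kinetic l u).
Local Notation E := (total_power nu gamma l Du).
Local Notation N0 := (fine (normsq l (fun x => mxnorm (u0 x)))).

Lemma normsq_u0 : normsq l (fun x => mxnorm (u0 x)) = N0%:E.
Proof. by rewrite fineK// ge0_fin_numE// normsq_ge0. Qed.

Lemma measurable_norm_u0 :
  measurable_fun (Omega l) (fun x : R3m R => mxnorm (u0 x)).
Proof. by apply: measurable_mxnorm => i j; rewrite (ord1 i). Qed.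

Lemma kinetic0 : N 0 = N0%:E.
Proof.
rewrite -normsq_u0; apply: ge0_ae_eq_integral => //.
- apply/measurable_EFinP/measurable_funX.
  exact: (measurable_speed u_class (lexx 0)).
- apply/measurable_EFinP/measurable_funX; exact: measurable_norm_u0.
- by move=> x _; rewrite lee_fin sqr_ge0.
- by move=> x _; rewrite lee_fin sqr_ge0.
have [_ uu0 _ _] := u_sol.
by apply: filterS uu0 => x uu0 Ox; rewrite uu0.
Qed.

(** Young with a free weight stands in for Cauchy-Schwarz in space-time; per unit time and volume, s
    = U/F makes both halves equal to F U / 2 in the limit. *)
Lemma integral_inner_force_le (s T : R) : 0 < s -> 0 < T ->
  \int[@lebesgue_measure R]_(t in `[0, T]) inner l f (u t)
  <= s * A * T / 2 + W T / (2 * s).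
Proof.
move=> s0 T0.
have A0 := A_ge0 l f.
have s20 : 0 <= s / 2 by rewrite divr_ge0// ltW.
have s2V0 : 0 <= (2 * s)^-1 by rewrite invr_ge0 mulr_ge0// ltW.
rewrite -lee_fin.
have -> : ((s * A * T / 2 + W T / (2 * s))%:E =
    \int[@lebesgue_measure R]_(t in `[0%R, T])
      ((s / 2 * A)%:E + ((2 * s)^-1)%:E * N t + 0%:E * P t))%E.
  rewrite (integral_comb nu_gt0 gamma_gt0 u_class)// ?mulr_ge0 ?(ltW s0)//.
  by congr EFin; rewrite mul0r addr0; ring.
have mI : measurable (`[0, T]%classic : set (measurableTypeR R)).
  exact: measurable_itv.
apply: ae_Rintegral_le => //.
- move=> t _; have N_ge0 := kinetic_ge0 l u t.
  have P_ge0 := power_ge0 l Du nu_gt0 gamma_gt0 t.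
  by rewrite adde_ge0 ?adde_ge0 ?mule_ge0 ?lee_fin ?mulr_ge0 ?(ltW s0).
- apply: (measurable_funS _ (@sub_half_line _ T)) => //.
  apply: emeasurable_funD; last first.
    apply: measurable_funeM; exact: (measurable_power _ _ u_class).
  apply: emeasurable_funD => //.
  by apply: measurable_funeM; exact: (measurable_kinetic u_class).
apply: nearW => t; rewrite /= in_itv/= => /andP[t0 _].
rewrite mul0e adde0 EFinM -normsq_force//.
apply: (@le_trans _ _ (`|inner l f (u t)|%:E)%E).
  by rewrite lee_fin ler_norm.
apply: normr_inner_le => //.
- exact: measurable_norm_force.
- exact: (measurable_speed u_class t0).
apply: nearW => x _; apply: le_trans (normr_mxdot_le _ _) _.
set a := mxnorm _; set b := mxnorm _.
rewrite -subr_ge0 (_ : _ - _ = (s * a - b) ^+ 2 / (2 * s)).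
  by rewrite divr_ge0 ?sqr_ge0// mulr_ge0// ltW.
by field; rewrite gt_eqF.
Qed.

Lemma energy_bound (s T : R) : 0 < s -> 0 < T ->
  E T <= N0 / 2 + s * A * T / 2 + W T / (2 * s).
Proof.
move=> s0 T0; have [_ _ _ /(_ T T0)] := u_sol.
rewrite -/(kinetic l u T) -/(kinetic l u 0) kinetic0.
have := total_powerE nu_gt0 gamma_gt0 u_class T0.
rewrite /power /enstrophy /compression => ->.
have N_ge0 : (0 <= (2^-1)%:E * kinetic l u T)%E.
  by rewrite mule_ge0 ?kinetic_ge0// lee_fin.
move=> /(le_trans (leeDr _ N_ge0)); rewrite -EFinM -EFinD lee_fin.
by have := integral_inner_force_le s0 T0; lra.
Qed.

(** Only times up to (1 - d)T are counted, where [cutoff_ge] applies; the remaining contribution is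
    nonnegative. *)
Lemma cutoff_integral_ge (n d T : R) : 0 < n -> 0 < d < 1 -> 0 < T ->
  1 <= n * d ->
  A * ((1 - (n * d)^-1) * ((1 - d) * T)) <=
  \int[@lebesgue_measure R]_(t in `[0, +oo[)
    inner l f (fun x => cutoff n T t *: f x).
Proof.
move=> n0 /andP[d0 d1] T0 nd1; have A0 := A_ge0 l f.
have th0 t : 0 <= cutoff n T t by exact: cutoff_ge0.
have cthE : (\int[@lebesgue_measure R]_(t in `[0, +oo[)
    inner l f (fun x => cutoff n T t *: f x))
    = \int[@lebesgue_measure R]_(t in `[0, +oo[) (cutoff n T t * A).
  apply: eq_Rintegral => t _; rewrite -inner_force /inner -RintegralZl//.
    by apply: eq_Rintegral => x _; rewrite mxdotZr.
  have fi := integrable_sqr_mul l_gt0.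
  rewrite (_ : _ \o _ = EFin \o (fun x => mxnorm (f x) * mxnorm (f x))).
    apply: fi.
    - exact: measurable_norm_force.
    - by rewrite normsq_force// ltry.
    - exact: continuous_norm_force.
  by apply/funext => x /=; rewrite -sqr_mxnorm.
have dT0 : 0 < (1 - d) * T by rewrite mulr_gt0// subr_gt0.
have q0 : 0 <= 1 - (n * d)^-1.
  by rewrite subr_ge0 invf_le1// (lt_le_trans _ nd1).
(* A lower bound on a real integral first requires finiteness, as [fine] sends +oo to 0. The
   integral is at most A T, since the cutoff is at most 1 and vanishes after T. *)
rewrite cthE /Rintegral -lee_fin fineK; last first.
  rewrite ge0_fin_numE; last first.
    by apply: integral_ge0 => t _; rewrite lee_fin mulr_ge0.
  apply: (@le_lt_trans _ _ (\int[@lebesgue_measure R]_(t in `[0%R, +oo[)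
      ((cst A%:E) \_ (`[0%R, T]%classic)) t)%E).
    apply: le_integral_dom => t.
      by move=> _; rewrite patchE; case: ifP => _ //=; rewrite lee_fin.
    rewrite /= in_itv/= andbT => t0; rewrite patchE; case: ifPn => tT /=.
      by rewrite lee_fin ler_piMl// cutoff_le1.
    rewrite cutoff_eq0//; first by rewrite mul0r.
    rewrite leNgt; apply: contra tT => tT; rewrite inE /= in_itv/= t0.
    exact: ltW.
  rewrite -integral_mkcondr integral_cst//; last first.
    by apply: measurableI; exact: measurable_itv.
  rewrite setIidr; last exact: sub_half_line.
  rewrite /= lebesgue_measure_itv/= lte_fin T0 oppr0 adde0 -EFinM.
  exact: ltry.
pose q := A * (1 - (n * d)^-1); pose T' := (1 - d) * T.
rewrite (_ : (_)%:E = \int[@lebesgue_measure R]_(t in `[0%R, +oo[)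
   ((cst q%:E) \_ (`[0%R, T']%classic)) t)%E.
  apply: le_integral_dom => t _; first by rewrite lee_fin mulr_ge0.
  rewrite patchE; case: ifPn => tT; last by rewrite lee_fin mulr_ge0.
  rewrite /= lee_fin /q [leRHS]mulrC ler_wpM2l// cutoff_ge//.
  by move: tT; rewrite inE /= in_itv/= => /andP[].
rewrite -integral_mkcondr integral_cst//; last first.
  by apply: measurableI; exact: measurable_itv.
rewrite setIidr; last exact: sub_half_line.
by rewrite /= lebesgue_measure_itv/= lte_fin dT0 oppr0 adde0 -EFinM /q -mulrA.
Qed.

Lemma weak_integrand_integral_le (s n T : R) : 0 < s -> 0 < n -> 0 < T ->
  \int[@lebesgue_measure R]_(t in `[0, +oo[)
    weak_integrand nu gamma l f u Du (cutoff n T t) (derive1 (cutoff n T) t) t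
  <= (n / T * A + nu * s / 2 * B) * T
     + (n / T + m + s * k ^+ 2 / (8 * gamma)) * W T + (2 * s)^-1 * E T.
Proof.
move=> s0 n0 T0; have A0 := A_ge0 l f; have B0 := B_ge0 l f.
have nT0 : 0 < n / T by rewrite divr_gt0.
have m0 : 0 <= m by exact: norm_inf_ge0.
have c10 : 0 <= n / T * A + nu * s / 2 * B.
  by rewrite addr_ge0// mulr_ge0// ?ltW// divr_gt0// mulr_gt0.
have c20 : 0 <= n / T + m + s * k ^+ 2 / (8 * gamma).
  have q0 : 0 <= s * k ^+ 2 / (8 * gamma).
    by rewrite divr_ge0 ?mulr_ge0 ?sqr_ge0 ?norm_inf_ge0 ?(ltW s0) ?(ltW
      gamma_gt0).
  by rewrite addr_ge0// addr_ge0// ltW.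
have c30 : 0 <= (2 * s)^-1 by rewrite invr_ge0 mulr_ge0 ?(ltW s0).
have mI : measurable (`[0, T]%classic : set (measurableTypeR R)).
  exact: measurable_itv.
have mJ : measurable (`[0, +oo[%classic : set (measurableTypeR R)).
  exact: measurable_itv.
rewrite -lee_fin; have := integral_comb nu_gt0 gamma_gt0 u_class c10 c20 c30 T0.
move=> <-.
set H := (fun t => (_ + _ * N t + _ * P t)%E).
have H0 t : (0 <= H t)%E.
  have N_ge0 := kinetic_ge0 l u t.
  have P_ge0 := power_ge0 l Du nu_gt0 gamma_gt0 t.
  by rewrite /H !adde_ge0 ?mule_ge0 ?lee_fin.
have mH : measurable_fun (`[0, +oo[%classic : set (measurableTypeR R)) H.
  apply: emeasurable_funD; last first.
    apply: measurable_funeM; exact: (measurable_power _ _ u_class).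
  apply: emeasurable_funD => //.
  by apply: measurable_funeM; exact: (measurable_kinetic u_class).
(* The majorant is extended by 0 past T to match the half-line of the weak formulation; there the
   cutoff and its derivative vanish, and so does the integrand. *)
have -> : (\int[@lebesgue_measure R]_(t in `[0%R, T]) H t =
    \int[@lebesgue_measure R]_(t in `[0%R, +oo[) (H \_ (`[0%R, T]%classic))
      t)%E.
  by rewrite -integral_mkcondr setIidr//; exact: sub_half_line.
apply: ae_Rintegral_le => //.
- by move=> t _; rewrite patchE; case: ifP.
- by apply/(measurable_restrict _ mI mJ); apply: measurable_funS mH => //;
  exact: subIsetl.
have [_ _ _ wg] := u_class.
(* [energy_class] provides the weak gradient at positive times only, so the null set {0} is
   discarded. *)
have ne0 : {ae @lebesgue_measure R, forall t : R, t != 0}.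
  exists [set 0]; split; [exact: measurable_set1|exact: lebesgue_measure_set1|].
  by move=> t /= /negP; rewrite negbK => /eqP.
have FF := ae_filter_ringOfSetsType (@lebesgue_measure R).
apply: (@filterS2 _ _ FF _ _ _ _ wg ne0) => t wgt tn0; rewrite /= in_itv/=
  andbT => t0.
have {wgt}wgt : weak_gradient l (u t) (Du t) by apply: wgt; rewrite lt_neqAle
  eq_sym tn0.
rewrite patchE; case: ifPn => tT.
  have c0 : 0 < 2 * n / T by rewrite divr_gt0// mulr_gt0.
  have th01 : 0 <= cutoff n T t <= 1 by rewrite cutoff_ge0 cutoff_le1.
  have := weak_integrand_le nu_gt0 gamma_gt0 l_gt0 f_smooth f_per f_div
    u_class s0 c0 th01 (normr_derive_cutoff n0 T0 t) t0 wgt.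
  by rewrite /H (_ : 2 * n / T / 2 = n / T)//; field; rewrite gt_eqF.
have Tt : T <= t.
  rewrite leNgt; apply: contra tT => tT; rewrite inE /= in_itv/= t0.
  exact: ltW.
rewrite lee_fin /weak_integrand cutoff_eq0// derive_cutoff_eq0//.
have z x : (0 : R) *: f x = 0 by rewrite scale0r.
have z1 v : inner l v (fun x => (0 : R) *: f x) = 0 by exact: inner0r.
have z2 v : inner l v (grad (fun x => (0 : R) *: f x)) = 0.
  by apply: inner0r => x; rewrite gradZ// scale0r.
have z3 v : inner l v (laplacian (fun x => (0 : R) *: f x)) = 0.
  by apply: inner0r => x; rewrite laplacianZ// scale0r.
rewrite !z1 z2 z3.
by rewrite grad_div_scale_eq0// !mulr0 !subr0 oppr0.
Qed.

Lemma momentum_bound (s n d T : R) :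
  0 < s -> 0 < n -> 0 < d < 1 -> 0 < T -> 1 <= n * d ->
  A * ((1 - (n * d)^-1) * ((1 - d) * T)) <=
  (N0 + A) / 2 + (n / T * A + nu * s / 2 * B) * T
  + (n / T + m + s * k ^+ 2 / (8 * gamma)) * W T + (2 * s)^-1 * E T.
Proof.
move=> s0 n0 d01 T0 nd1.
have [_ _ dist _] := u_sol.
have := dist _ (test_field_sep (smooth_cutoff n T0)
  (fun t => cutoff_eq0 n0 T0 (t := t)) f_smooth f_per).
have -> : (fun t => (- inner l (u t) (time_derive (fun t x => cutoff n T t *: f
  x) t)
     - inner l (fun x => (u t x)^T *m u t x) (grad (fun x => cutoff n T t *: f
       x))
     - 2^-1 * inner l (fun x => \tr (Du t x) *: u t x) (fun x => cutoff n T t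
       *: f x)
     - nu * inner l (u t) (laplacian (fun x => cutoff n T t *: f x))
     - gamma * inner l (u t) (grad_div (fun x => cutoff n T t *: f x)))) =
  fun t => weak_integrand nu gamma l f u Du (cutoff n T t) (derive1 (cutoff n
    T) t) t.
  apply/funext => t; rewrite /weak_integrand.
  congr (- inner l (u t) _ - _ - _ - _ - _); apply/funext => x.
  by rewrite time_deriveZ//; exact: derivable_cutoff.
move=> E1.
have h1 := weak_integrand_integral_le s0 n0 T0.
have h2 := cutoff_integral_ge n0 d01 T0 nd1.
(* The initial-value term of the weak formulation: a bound independent of T, hence negligible after
   averaging. *)
have h3 : `|inner l u0 (fun x => cutoff n T 0 *: f x)| <= (N0 + A) / 2.
  rewrite -lee_fin (_ : ((N0 + A) / 2)%:E = (2^-1)%:E * N0%:E + (2^-1)%:E *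
    A%:E)%E.
    rewrite -normsq_u0 -normsq_force//; apply: normr_inner_le => //.
    - exact: measurable_norm_u0.
    - exact: measurable_norm_force.
    apply: nearW => x _; apply: le_trans (normr_mxdot_le _ _) _.
    rewrite mxnormZ ger0_norm ?cutoff_ge0//.
    have := mxnorm_ge0 (u0 x); have := mxnorm_ge0 (f x).
    set a := mxnorm (f x); set b := mxnorm (u0 x) => a0 b0.
    apply: (@le_trans _ _ (b * a)).
      by rewrite ler_wpM2l// ler_piMl// cutoff_le1.
    by have := sqr_ge0 (a - b); nra.
  by rewrite -!EFinM -EFinD; congr EFin; ring.
move: h3; rewrite ler_norml => /andP[h3 _]; lra.
Qed.

End Balances.

(** * Long-time averages *)

Section LimSup.
Context {R : realType}.
Implicit Types g : R -> \bar R.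

Lemma limf_esup_pinfty_lt g (c : \bar R) :
  (limf_esup g (pinfty_nbhs R) < c)%E -> \forall T \near +oo, (g T < c)%E.
Proof.
move=> /ereal_inf_lt[_ [V FV <-] Vc]; apply: filterS FV => T VT.
by apply: le_lt_trans Vc; apply: ereal_sup_ubound; exists T.
Qed.

Lemma limf_esup_pinfty_le g (c : \bar R) :
  (\forall T \near +oo, (g T <= c)%E) -> (limf_esup g (pinfty_nbhs R) <= c)%E.
Proof.
move=> gc; apply: ge_ereal_inf; exists (ereal_sup (g @` [set T | (g T <=
  c)%E])).
  by exists [set T | (g T <= c)%E].
by apply: ge_ereal_sup => _ [T /= gT <-].
Qed.

Lemma near_pinfty_div_le (q e : R) : 0 < e -> \forall T \near +oo, q / T <= e.
Proof.
move=> e0; exists (Num.max 0 (q / e)); split; first exact: num_real.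
move=> T; rewrite gt_max => /andP[T0 qT].
by rewrite ler_pdivrMr// mulrC -ler_pdivrMr// ltW.
Qed.

End LimSup.

(* The bound on [e] with [d = 0] is
   e <= 2 U^3/L + nu U^2/L^2 + k^2 U^4/(4 gamma); [d] collects all errors. *)
Lemma dissipation_algebra (R : realType) (U F L nu gamma k m b d e w q : R) :
  0 < U -> 0 < F -> 0 < L -> 0 < nu -> 0 < gamma -> 0 < d < 1 ->
  0 <= w <= U ^+ 2 + d -> 0 <= m <= F / L -> 0 <= b <= F ^+ 2 / L ^+ 2 ->
  q <= d ->
  e <= d + U / F * F ^+ 2 / 2 + w / (2 * (U / F)) ->
  U / F * F ^+ 2 * ((1 - d) * (1 - d)) <= d + U / F * (nu * (U / F) / 2 * b)
    + (q + U / F * m + U / F * (U / F * k ^+ 2 / (8 * gamma))) * w + e / 2 ->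
  e <= 2 * U ^+ 3 / L + nu * U ^+ 2 / L ^+ 2
       + k ^+ 2 / F ^+ 2 * U ^+ 4 / (4 * gamma)
     + d * (2 * (2 + F / (2 * U) + 2 * U * F + (U ^+ 2 + 1) + U / L
                 + U ^+ 2 * (k ^+ 2 / F ^+ 2) / (8 * gamma))).
Proof.
move=> U0 F0 L0 nu0 ga0 /andP[d0 d1] /andP[w0 w1] /andP[m0 m1] /andP[b0 b1] qd.
have sF : U / F * F ^+ 2 = U * F by field; rewrite gt_eqF.
have -> : w / (2 * (U / F)) = F / (2 * U) * w by field; rewrite !gt_eqF.
rewrite sF => he hm.
pose K := U ^+ 2 * (k ^+ 2 / F ^+ 2) / (8 * gamma).
have K0 : 0 <= K.
  apply: divr_ge0; last by rewrite mulr_ge0// ltW.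
  by apply: mulr_ge0; [|apply: divr_ge0]; exact: sqr_ge0.
have KE : U / F * (U / F * k ^+ 2 / (8 * gamma)) = K.
  by rewrite /K; field; rewrite !gt_eqF.
have smL : U / F * m <= U / L.
  apply: (@le_trans _ _ (U / F * (F / L))).
    by rewrite ler_wpM2l// divr_ge0// ltW.
  by rewrite le_eqVlt; apply/orP; left; apply/eqP; field; rewrite !gt_eqF.
have bL : U / F * (nu * (U / F) / 2 * b) <= nu * U ^+ 2 / (2 * L ^+ 2).
  apply: (@le_trans _ _ (U / F * (nu * (U / F) / 2 * (F ^+ 2 / L ^+ 2)))).
    have UF : 0 <= U / F by rewrite divr_ge0// ltW.
    apply: ler_wpM2l => //; apply: ler_wpM2l => //.
    by apply: divr_ge0 => //; apply: mulr_ge0 => //; exact: ltW.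
  by rewrite le_eqVlt; apply/orP; left; apply/eqP; field; rewrite !gt_eqF.
have UL0 : 0 <= U / L by rewrite divr_ge0// ltW.
have FU0 : 0 <= F / (2 * U) by rewrite divr_ge0 ?mulr_ge0// ltW.
have h1 : F / (2 * U) * w <= F / (2 * U) * (U ^+ 2 + d) by rewrite ler_wpM2l.
have h1E : F / (2 * U) * (U ^+ 2 + d) = U * F / 2 + d * (F / (2 * U)).
  by field; rewrite gt_eqF.
have h2 : (q + U / F * m + U / F * (U / F * k ^+ 2 / (8 * gamma))) * w
    <= (d + U / L + K) * (U ^+ 2 + d).
  rewrite KE; apply: (@le_trans _ _ ((d + U / L + K) * w)).
    by rewrite ler_wpM2r// lerD// lerD.
  by rewrite ler_wpM2l// !addr_ge0// ltW.
have UF0 : 0 < U * F by rewrite mulr_gt0.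
have h3 : U * F - 2 * d * (U * F) <= U * F * ((1 - d) * (1 - d)).
  by have := sqr_ge0 d; nra.
have h4 : (d + U / L + K) * (U ^+ 2 + d) <=
    (U / L + K) * U ^+ 2 + d * (U ^+ 2 + 1 + U / L + K).
  (* Absorbs the quadratic error, so that the total error is linear in [d]. *)
  have : d * d <= d by rewrite ler_piMl// ltW.
  by nra.
have E1 : 2 * U ^+ 3 / L = 2 * (U / L * U ^+ 2) by field; rewrite gt_eqF.
have E2 : nu * U ^+ 2 / L ^+ 2 = 2 * (nu * U ^+ 2 / (2 * L ^+ 2)).
  by field; rewrite gt_eqF.
have E3 : k ^+ 2 / F ^+ 2 * U ^+ 4 / (4 * gamma) = 2 * (K * U ^+ 2).
  by rewrite /K; field; rewrite !gt_eqF.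
rewrite E1 E2 E3 -/K.
move: h1 h1E h2 h3 h4 he hm bL.
set x1 := U / L * U ^+ 2; set x2 := nu * U ^+ 2 / _; set x3 := K * U ^+ 2.
move=> h1 h1E h2 h3 h4 he hm bL.
have : (U / L + K) * U ^+ 2 = x1 + x3 by rewrite mulrDl.
by lra.
Qed.

Section LongTime.
Context {R : realType} (nu gamma l : R).
Variables (f u0 : R3 R -> 'rV[R]_3) (u : R -> R3 R -> 'rV[R]_3)
  (Du : R -> R3 R -> 'M[R]_3).
Hypotheses (nu_gt0 : 0 < nu) (gamma_gt0 : 0 < gamma) (l_gt0 : 0 < l).
Hypotheses (f_smooth : smooth_field f) (f_per : space_periodic l f)
  (f_div : forall x, div f x = 0).
Hypothesis u0_meas :
  forall i, measurable_fun (Omega l) (fun x : R3m R => u0 x 0 i).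
Hypothesis u0_L2 : (normsq l (fun x => mxnorm (u0 x)) < +oo)%E.
Hypothesis u_sol : weak_solution l nu gamma f u0 u Du.

Let u_class : energy_class l u Du. Proof. by have [] := u_sol. Qed.
Let vol_gt0 : 0 < vol l. Proof. by rewrite exprn_gt0. Qed.

Local Notation A := (fine (normsq l (fun x => mxnorm (f x)))).
Local Notation B := (fine (normsq l (fun x => mxnorm (grad f x)))).
Local Notation k := (norm_inf l (fun x => mxnorm (f x))).
Local Notation m := (norm_inf l (fun x => mxnorm (grad f x))).
Local Notation W := (total_kinetic l u).
Local Notation E := (total_power nu gamma l Du).
Local Notation N0 := (fine (normsq l (fun x => mxnorm (u0 x)))).

Definition mean_kinetic (T : R) : R := W T / (T * vol l).
Definition mean_power (T : R) : R := E T / (T * vol l).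

Lemma mean_kinetic_ge0 T : 0 < T -> 0 <= mean_kinetic T.
Proof.
by move=> T0; rewrite divr_ge0 ?total_kinetic_ge0 ?mulr_ge0// ltW.
Qed.

Lemma average_kineticE T : 0 < T ->
  ((T^-1)%:E * \int[@lebesgue_measure R]_(t in `[0%R, T])
     ((vol l)^-1%:E * normsq l (fun x => mxnorm (u t x))))%E
  = (mean_kinetic T)%:E.
Proof.
move=> T0.
have vV0 : 0 <= (vol l)^-1 by rewrite invr_ge0 ltW.
have mI : measurable (`[0, T]%classic : set (measurableTypeR R)).
  exact: measurable_itv.
rewrite ge0_integralZl_EFin//; last 2 first.
- by move=> t _; exact: normsq_ge0.
- apply: (measurable_funS _ (@sub_half_line _ T)) => //.
  exact: (measurable_kinetic u_class).
rewrite -[X in (_ * (_ * X))%E]/(\int[@lebesgue_measure R]_(t in `[0%R, T])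
  kinetic l u t)%E.
rewrite (total_kineticE u_class)// -!EFinM; congr EFin; rewrite /mean_kinetic.
by field; rewrite !gt_eqF.
Qed.

Lemma dissipationE t : 0 <= t ->
  dissipation l nu gamma (Du t) = ((vol l)^-1%:E * power nu gamma l Du t)%E.
Proof.
move=> t0; rewrite /dissipation /power; congr (_ * _)%E.
apply: normsq_comb; rewrite ?ltW//.
- exact: (measurable_gradient_norm u_class t0).
- exact: (measurable_divergence u_class t0).
Qed.

Lemma average_dissipationE T : 0 < T ->
  ((T^-1)%:E * \int[@lebesgue_measure R]_(t in `[0%R, T])
     dissipation l nu gamma (Du t))%E
  = (mean_power T)%:E.
Proof.
move=> T0.
have vV0 : 0 <= (vol l)^-1 by rewrite invr_ge0 ltW.
have mI : measurable (`[0, T]%classic : set (measurableTypeR R)).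
  exact: measurable_itv.
rewrite (eq_integral (fun t : measurableTypeR R =>
    (vol l)^-1%:E * power nu gamma l Du t)%E); last first.
  by move=> t; rewrite inE /= in_itv/= => /andP[t0 _]; rewrite dissipationE.
rewrite ge0_integralZl_EFin//; last 2 first.
- by move=> t _; exact: power_ge0.
- apply: (measurable_funS _ (@sub_half_line _ T)) => //.
  exact: (measurable_power _ _ u_class).
rewrite (total_powerE nu_gt0 gamma_gt0 u_class)// -!EFinM; congr EFin.
by rewrite /mean_power; field; rewrite !gt_eqF.
Qed.

Lemma mean_power_le (s T : R) : 0 < s -> 0 < T ->
  mean_power T <= N0 / (2 * vol l) / T + s * ((vol l)^-1 * A) / 2
                  + mean_kinetic T / (2 * s).
Proof.
move=> s0 T0; have := energy_bound nu_gt0 gamma_gt0 l_gt0 f_smooth u0_meas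
  u0_L2 u_sol s0 T0.
rewrite -(ler_pM2r (x := (T * vol l)^-1)) ?invr_gt0 ?mulr_gt0// => /le_trans;
  apply.
rewrite /mean_kinetic le_eqVlt; apply/orP; left; apply/eqP; field.
by rewrite !gt_eqF.
Qed.

Lemma mean_momentum_le (s d T : R) : 0 < s -> 0 < d < 1 -> 0 < T ->
  s * ((vol l)^-1 * A) * ((1 - d) * (1 - d)) <=
  (s * (N0 + A) / (2 * vol l) + s * d ^- 2 * ((vol l)^-1 * A)) / T
  + s * (nu * s / 2 * ((vol l)^-1 * B))
  + (s * d ^- 2 / T + s * m + s * (s * k ^+ 2 / (8 * gamma))) * mean_kinetic T
  + mean_power T / 2.
Proof.
move=> s0 d01 T0; have /andP[d0 d1] := d01.
(* Steepness n = d^-2 gives n d = 1/d, so the height and the length lost by the cutoff both cost a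
   factor 1 - d, while n stays fixed as T grows. *)
have n0 : 0 < d ^- 2 by rewrite invr_gt0 exprn_gt0.
have nd : d ^- 2 * d = d^-1 by field; rewrite gt_eqF.
have nd1 : 1 <= d ^- 2 * d by rewrite nd invf_ge1// ltW.
have := momentum_bound nu_gt0 gamma_gt0 l_gt0 f_smooth f_per f_div u0_meas
  u0_L2 u_sol s0 n0 d01 T0 nd1.
(* The extra factor [s] turns the coefficient (2s)^-1 of the dissipation into 1/2. *)
rewrite nd invrK -(ler_pM2r (x := s / (T * vol l))) ?divr_gt0 ?mulr_gt0//.
rewrite (_ : A * _ * _ = s * ((vol l)^-1 * A) * ((1 - d) * (1 - d))); last
  first.
  by field; rewrite !gt_eqF.
move=> /le_trans; apply; rewrite /mean_kinetic /mean_power.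
rewrite le_eqVlt; apply/orP; left; apply/eqP; field.
by rewrite !gt_eqF.
Qed.

End LongTime.

(** * Consequences of a positive length scale *)

Section Scales.
Context {R : realType} (l : R) (f : R3 R -> 'rV[R]_3).
Hypothesis l_gt0 : 0 < l.

Local Notation F := (F_scale l f).
Local Notation L := (L_scale l f).

Lemma mean_sq_ge0 (g : R3 R -> R) : 0 <= mean_sq l g.
Proof.
by rewrite mulr_ge0 ?invr_ge0 ?fine_ge0 ?normsq_ge0// exprn_ge0// ltW.
Qed.

Lemma F_scale_ge0 : 0 <= F. Proof. exact: sqrtr_ge0. Qed.

Lemma sqr_F_scale : F ^+ 2 = mean_sq l (fun x => mxnorm (f x)).
Proof. by rewrite sqr_sqrtr// mean_sq_ge0. Qed.

Lemma L_scale_ge0 : 0 <= L.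
Proof.
rewrite !le_min (ltW l_gt0)/=.
by rewrite !divr_ge0 ?F_scale_ge0 ?norm_inf_ge0 ?sqrtr_ge0.
Qed.

(** Since division by 0 gives 0, a positive minimum forces F and both denominators to be positive;
    the two bounds then rearrange L <= F/x. *)
Lemma L_scale_gt0 : 0 < L ->
  [/\ 0 < F, norm_inf l (fun x => mxnorm (grad f x)) <= F / L &
      mean_sq l (fun x => mxnorm (grad f x)) <= F ^+ 2 / L ^+ 2].
Proof.
move=> L0; have := L0; rewrite {1}/L_scale !lt_min => /and3P[_ Fm Fb].
have F0 : 0 < F.
  rewrite lt_neqAle F_scale_ge0 andbT; apply/eqP => F0.
  by move: Fm; rewrite -F0 mul0r ltxx.
have le_FL (x : R) : 0 < F / x -> L <= F / x -> x <= F / L.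
  rewrite pmulr_rgt0// invr_gt0 => x0; rewrite ler_pdivlMr// => Lx.
  by rewrite ler_pdivlMr// mulrC.
have lem : L <= F / norm_inf l (fun x => mxnorm (grad f x)).
  by rewrite /L_scale !ge_min lexx orbT.
have leb : L <= F / Num.sqrt (mean_sq l (fun x => mxnorm (grad f x))).
  by rewrite /L_scale !ge_min lexx !orbT.
split => //; first exact: le_FL.
rewrite -[leLHS]sqr_sqrtr ?mean_sq_ge0// -expr_div_n.
by rewrite lerXn2r ?nnegrE ?sqrtr_ge0 ?divr_ge0 ?F_scale_ge0 ?(ltW L0)// le_FL.
Qed.

End Scales.

(** * Passage to the limit in the averaged balances *)

Section Main.
Context {R : realType} (nu gamma l : R).
Variables (f u0 : R3 R -> 'rV[R]_3) (u : R -> R3 R -> 'rV[R]_3)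
  (Du : R -> R3 R -> 'M[R]_3).
Hypotheses (nu_gt0 : 0 < nu) (gamma_gt0 : 0 < gamma) (l_gt0 : 0 < l).
Hypotheses (f_smooth : smooth_field f) (f_per : space_periodic l f)
  (f_div : forall x, div f x = 0).
Hypothesis u0_meas :
  forall i, measurable_fun (Omega l) (fun x : R3m R => u0 x 0 i).
Hypothesis u0_L2 : (normsq l (fun x => mxnorm (u0 x)) < +oo)%E.
Hypothesis u_sol : weak_solution l nu gamma f u0 u Du.

Local Notation F := (F_scale l f).
Local Notation L := (L_scale l f).
Local Notation U2 := (time_average
    (fun t => (vol l)^-1%:E * normsq l (fun x => mxnorm (u t x)))%E).

Let u_class : energy_class l u Du. Proof. by have [] := u_sol. Qed.

Lemma average_kinetic_ge0 : (0 <= U2)%E.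
Proof.
rewrite leNgt; apply/negP => /limf_esup_pinfty_lt h.
have [T [/=]] := filter_ex (filterI h (nbhs_pinfty_gt (num_real (0 : R)))).
move=> hT T0; move: hT; rewrite (average_kineticE l_gt0 u_sol)//.
by rewrite lte_fin ltNge mean_kinetic_ge0.
Qed.

Lemma near_mean_kinetic_lt (c : R) : (U2 < c%:E)%E ->
  \forall T \near +oo, mean_kinetic l u T < c.
Proof.
move=> /limf_esup_pinfty_lt h.
apply: filterS (filterI h (nbhs_pinfty_gt (num_real (0 : R)))) => T [/= hT T0].
by move: hT; rewrite (average_kineticE l_gt0 u_sol).
Qed.

Lemma average_dissipation_le (c : R) :
  (\forall T \near +oo, mean_power nu gamma l Du T <= c) ->
  (time_average (fun t => dissipation l nu gamma (Du t)) <= c%:E)%E.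
Proof.
move=> h; apply: limf_esup_pinfty_le.
apply: filterS (filterI h (nbhs_pinfty_gt (num_real (0 : R)))) => T [/= hT T0].
by rewrite (average_dissipationE nu_gt0 gamma_gt0 l_gt0 u_sol).
Qed.

(** The choice s = U/F degenerates here, so [s] is kept as a small free weight in the energy balance
    alone; the mean kinetic term is eventually below s^2, which survives division by 2s. *)
Lemma average_dissipation_le0 : U2 = 0%E ->
  (time_average (fun t => dissipation l nu gamma (Du t)) <= 0)%E.
Proof.
move=> U20; apply/lee_addgt0Pr => e e0; rewrite add0e.
pose a : R := (vol l)^-1 * fine (normsq l (fun x => mxnorm (f x))).
have a0 : 0 <= a by exact: mean_sq_ge0.
(* The three terms of [mean_power_le] are at most s, s a/2 and s/2, whose sum is below s (2 + a). *)
have [s s0 sE] : exists2 s : R, 0 < s & s * (2 + a) = e.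
  exists (e / (2 + a)); first by rewrite divr_gt0// ltr_wpDr.
  by rewrite divfK// gt_eqF// ltr_wpDr.
apply: average_dissipation_le.
have hw := near_mean_kinetic_lt (c := s ^+ 2).
rewrite U20 lte_fin exprn_gt0// in hw; have {}hw := hw isT.
have hq := near_pinfty_div_le
  (fine (normsq l (fun x => mxnorm (u0 x))) / (2 * vol l)) s0.
apply: filterS (filterI (filterI hw hq) (nbhs_pinfty_gt (num_real (0 : R)))).
move=> T [[/= wT qT] T0].
have := mean_power_le nu_gt0 gamma_gt0 l_gt0 f_smooth u0_meas u0_L2 u_sol s0 T0.
move=> /le_trans; apply; rewrite -/a -sE.
have : mean_kinetic l u T / (2 * s) <= s / 2.
  have -> : s / 2 = s ^+ 2 / (2 * s) by field; rewrite gt_eqF.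
  by rewrite ler_pM2r ?invr_gt0 ?mulr_gt0// ltW.
have : 0 <= s * a by rewrite mulr_ge0// ltW.
by rewrite mulrDr; lra.
Qed.

(** Order of limits: [d], and with it the steepness of the cutoff, is fixed from the tolerance [e]
    before T grows, so every 1/T remainder is eventually at most [d]. *)
Lemma average_dissipation_le_finite (U : R) : 0 < U -> 0 < L -> U2 = (U ^+
  2)%:E ->
  (time_average (fun t => dissipation l nu gamma (Du t))
   <= (2 * U ^+ 3 / L + nu * U ^+ 2 / L ^+ 2
       + kappa l f ^+ 2 * U ^+ 4 / (4 * gamma))%:E)%E.
Proof.
move=> U0 L0 U2E.
have [F0 mF bF] := L_scale_gt0 l_gt0 L0.
have F2 := sqr_F_scale f l_gt0.
have -> : kappa l f ^+ 2 = norm_inf l (fun x => mxnorm (f x)) ^+ 2 / F ^+ 2.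
  by rewrite F2 [LHS]sqr_sqrtr// divr_ge0 ?sqr_ge0// mean_sq_ge0.
set k := norm_inf l _; set X := _ + _ + _.
(* The factor multiplying [d] in [dissipation_algebra]. *)
pose C : R := 2 * (2 + F / (2 * U) + 2 * U * F + (U ^+ 2 + 1) + U / L
                 + U ^+ 2 * (k ^+ 2 / F ^+ 2) / (8 * gamma)).
have C0 : 0 < C.
  rewrite mulr_gt0// -!addrA ltr_pwDl//.
  rewrite !addr_ge0 ?mulr_ge0 ?divr_ge0 ?invr_ge0 ?mulr_ge0 ?divr_ge0
    ?norm_inf_ge0 ?(ltW U0) ?(ltW F0) ?(ltW L0) ?(ltW gamma_gt0) ?sqr_ge0//.
apply/lee_addgt0Pr => e e0; rewrite -EFinD.
pose d : R := Num.min (2^-1) (e / C).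
have d0 : 0 < d by rewrite lt_min invr_gt0 ltr0n divr_gt0.
have d1 : d < 1.
  by rewrite gt_min; apply/orP; left; rewrite invf_lt1// ltr1n.
have dC : d * C <= e by rewrite -ler_pdivlMr// ge_min lexx orbT.
have d01 : 0 < d < 1 by rewrite d0 d1.
apply: average_dissipation_le.
have hw : \forall T \near +oo, mean_kinetic l u T < U ^+ 2 + d.
  by apply: near_mean_kinetic_lt; rewrite U2E lte_fin ltrDl.
(* The weight that balances s F^2/2 against U^2/(2s), both then being F U / 2. *)
pose s : R := U / F.
have s0 : 0 < s by rewrite divr_gt0.
pose N0 : R := fine (normsq l (fun x => mxnorm (u0 x))).
pose A : R := fine (normsq l (fun x => mxnorm (f x))).
have h1 := near_pinfty_div_le (N0 / (2 * vol l)) d0.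
have h2 := near_pinfty_div_le
  (s * (N0 + A) / (2 * vol l) + s * d ^- 2 * ((vol l)^-1 * A)) d0.
have h3 := near_pinfty_div_le (s * d ^- 2) d0.
apply: filterS (filterI (filterI hw h1)
  (filterI (filterI h2 h3) (nbhs_pinfty_gt (num_real (0 : R))))).
move=> T [[/= wT q1] [[q2 q3] T0]].
have e1 := mean_power_le nu_gt0 gamma_gt0 l_gt0 f_smooth u0_meas u0_L2 u_sol s0
  T0.
have e2 := mean_momentum_le nu_gt0 gamma_gt0 l_gt0 f_smooth f_per f_div u0_meas
  u0_L2 u_sol s0 d01 T0.
apply: (@le_trans _ _ (X + d * C)); last by rewrite lerD2l.
apply: (@dissipation_algebra _ U F L nu gamma k
  (norm_inf l (fun x => mxnorm (grad f x))) (mean_sq l (fun x => mxnorm (grad f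
    x)))
  d _ (mean_kinetic l u T) (s * d ^- 2 / T)) => //.
- by rewrite mean_kinetic_ge0// ltW.
- by rewrite norm_inf_ge0.
- by rewrite mean_sq_ge0.
- by rewrite F2 /mean_sq; apply: le_trans e1 _; rewrite -/N0 !lerD2r.
- by rewrite F2 /mean_sq; apply: le_trans e2 _; rewrite -/N0 -/A !lerD2r.
Qed.

End Main.

Theorem theorem1 (R : realType) (nu gamma l : R)
    (f u0 : R3 R -> 'rV[R]_3)
    (u : R -> R3 R -> 'rV[R]_3) (Du : R -> R3 R -> 'M[R]_3)
    (nu_gt0 : 0 < nu) (gamma_gt0 : 0 < gamma) (l_gt0 : 0 < l)
    (f_smooth : smooth_field f) (f_neq0 : exists x, f x <> 0)
    (f_per : space_periodic l f) (f_mean : zero_mean l f)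
    (f_div : forall x, div f x = 0)
    (u0_meas : forall i,
       measurable_fun (Omega l) (fun x : R3m R => u0 x 0 i))
    (u0_L2 : (normsq l (fun x => mxnorm (u0 x)) < +oo)%E)
    (u0_per : space_periodic l u0) (u0_mean : zero_mean l u0)
    (u0_div : weakly_div_free l u0)
    (u_per : forall t, 0 <= t -> space_periodic l (u t))
    (u_mean : forall t, 0 <= t -> zero_mean l (u t))
    (u_sol : weak_solution l nu gamma f u0 u Du) :
  (time_average (fun t => dissipation l nu gamma (Du t))
   <= (6%:E + (reynolds l nu f u)^-1
       + (4^-1 * kappa l f ^+ 2)%:E * reynolds_gamma l gamma f u)
      * (U_scale l u ^+ 3 / (L_scale l f)%:E))%E.
Proof.
have U2_ge0 := average_kinetic_ge0 l_gt0 u_sol.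
have L_ge0 := L_scale_ge0 f l_gt0.
have U_ge0 : (0 <= U_scale l u)%E by exact: sqrte_ge0.
have U2E : (U_scale l u ^+ 2)%E = time_average
    (fun t => (vol l)^-1%:E * normsq l (fun x => mxnorm (u t x)))%E.
  exact: sqr_sqrte.
rewrite /reynolds /reynolds_gamma.
move: U_ge0 U2E; move: (U_scale l u) => U U_ge0 U2E.
(* Positivity of the prefactor ensures that its product with an infinite U^3/L is +oo. *)
have coef_gt0 : (0 < 6%:E + ((L_scale l f)%:E * U / nu%:E)^-1
    + (4^-1 * kappa l f ^+ 2)%:E * ((L_scale l f)%:E * U / gamma%:E))%E.
  have LU0 : (0 <= (L_scale l f)%:E * U)%E by rewrite mule_ge0// lee_fin.
  have LUinv0 (c : R) : 0 < c -> (0 <= (L_scale l f)%:E * U / c%:E)%E.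
    by move=> c0; rewrite mule_ge0// inve_ge0 lee_fin ltW.
  apply: (@lt_le_trans _ _ 6%:E); first by rewrite lte_fin.
  rewrite -addeA leeDl// adde_ge0 ?inve_ge0 ?LUinv0//.
  by rewrite mule_ge0 ?LUinv0// lee_fin mulr_ge0 ?sqr_ge0.
(* For U = 0 the inverse Reynolds number is +oo, but it multiplies U^3/L = 0 and the product is 0 in
   [\bar R]. *)
have [U0|U0] := eqVneq U 0%E.
  rewrite {3}U0 expeS !mul0e mule0; apply: (average_dissipation_le0 nu_gt0
    gamma_gt0 l_gt0 f_smooth
    u0_meas u0_L2 u_sol).
  by rewrite -U2E U0 expe2 mul0e.
have U_gt0 : (0 < U)%E by rewrite lt_neqAle eq_sym U0.
have [L0|L0] := eqVneq (L_scale l f) 0.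
  rewrite L0 inve0 in coef_gt0 *.
  by rewrite gt0_muley ?expe_gt0// gt0_muley// leey.
have L_gt0 : 0 < L_scale l f by rewrite lt_neqAle eq_sym L0.
move: U U_ge0 U2E coef_gt0 U0 U_gt0 => [U| |]//; last first.
  move=> _ _ coef_gt0 _ _.
  have -> : (+oo ^+ 3 / (L_scale l f)%:E = +oo :> \bar R)%E.
    rewrite !expeS expe0 mule1 !mulyy inver (negbTE L0).
    by rewrite gt0_mulye// lte_fin invr_gt0.
  by rewrite gt0_muley// leey.
move=> _ U2E _ _; rewrite lte_fin => U_gt0.
have := average_dissipation_le_finite nu_gt0 gamma_gt0 l_gt0 f_smooth f_per
  f_div u0_meas u0_L2 u_sol U_gt0 L_gt0.
rewrite -U2E EFin_expe => /(_ erefl) /le_trans; apply.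
rewrite -EFin_expe !inver !gt_eqF// -!EFinM inver gt_eqF ?divr_gt0 ?mulr_gt0//.
rewrite -!EFinD -EFinM lee_fin.
set k := kappa l f; set L := L_scale l f in L_gt0 *.
(* The last two terms agree exactly on both sides; what remains is the slack between the constants 6
   and 2. *)
rewrite -subr_ge0 (_ : _ - _ = 4 * U ^+ 3 / L).
  by rewrite divr_ge0 ?mulr_ge0 ?exprn_ge0// ltW.
by field; rewrite !gt_eqF.
Qed.
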